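(* Let $n\in\mathbb{N}$, $X\subset\mathbb{R}^{n}$ (an arbitrary subset, not necessarily measurable), $x\in\mathbb{R}^{n}$ and $\alpha\in(0,\infty)$. Then the following hold. \begin{itemize} \item If $1/\Delta[X]<\infty$ and $\mathcal{H}^{1}(X)<\infty$, then $X$ has an approximate $1$-tangent at $x$. \item If $p\in[\alpha,\infty)$ and $\mathcal{U}_{p}^{\alpha}(X)<\infty$, then $X$ has an approximate $\alpha$-tangent at $x$. \item If $p\in[2\alpha,\infty)$, $\mathcal{I}_{p}^{\alpha}(X)<\infty$ and $\Theta_{*}^{\alpha}(\mathcal{H}^{\alpha},X,x)>0$, then $X$ has a weak approximate $\alpha$-tangent at $x$. \item If $p\in[3\alpha,\infty)$, $\mathcal{M}_{p}^{\alpha}(X)<\infty$ and $0<\Theta_{*}^{\alpha}(\mathcal{H}^{\alpha},X,x)\leq\Theta^{*\alpha}(\mathcal{H}^{\alpha},X,x)<\infty$, then $X$ has a weak approximate $\alpha$-tangent at $x$. \end{itemize}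
   Context: $\mathcal{H}^{\alpha}$ is the $\alpha$-dimensional Hausdorff (outer) measure, normalized by sums of $(\operatorname{diam})^{\alpha}$ (so $\mathcal{H}^1$ is length on lines). For mutually distinct points $x,y,z$ let $r(x,y,z)\in(0,\infty]$ be the circumradius: with $a=|x-y|$, $b=|y-z|$, $c=|z-x|$, $r(x,y,z)=abc/\sqrt{(a+b+c)(a+b-c)(a-b+c)(-a+b+c)}$, and $r=\infty$ if the denominator vanishes (collinear points). Conventions: $1/0=\infty$, $1/\infty=0$, $\inf\emptyset=\infty$. For a set $X$: - thickness: $\Delta[X]=\inf\{r(u,v,w): u,v,w\in X \text{ mutually distinct}\}$; - $\kappa(x,y,z)=1/r(x,y,z)$ if $x,y,z\in X$ are mutually distinct, and $0$ otherwise; - $\kappa_i(x,y)=1/\inf_{w\in X\setminus\{x,y\}} r(x,y,w)$ if $x\neq y$, and $\kappa_i(x,x)=0$; - $\kappa_G(x)=1/\inf\{r(x,v,w): v,w\in X,\ x,v,w \text{ mutually distinct}\}$. For $\alpha,p\in(0,\infty)$ the energies are $\mathcal{U}_p^{\alpha}(X)=\int_X\kappa_G^p\,d\mathcal{H}^\alpha$, $\mathcal{I}_p^{\alpha}(X)=\int_X\int_X\kappa_i^p(x,y)\,d\mathcal{H}^\alpha(x)d\mathcal{H}^\alpha(y)$, $\mathcal{M}_p^{\alpha}(X)=\int_X\int_X\int_X\kappa^p(x,y,z)\,d\mathcal{H}^\alpha(x)d\mathcal{H}^\alpha(y)d\mathcal{H}^\alpha(z)$. Here $\mathcal{H}^\alpha$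 is the Hausdorff measure on the metric space $X$ (with the restricted metric), integrals being taken with respect to its Carathéodory measurable subsets of $X$; all integrands are Borel on $X$, so the energies are defined in $[0,\infty]$ also for non-measurable $X\subset\mathbb{R}^n$. $\overline B_r(x)$ is the closed ball. Densities: $\Theta_*^\alpha(\mathcal{H}^\alpha,X,x)=\liminf_{r\downarrow0}\mathcal{H}^\alpha(X\cap\overline B_r(x))/(2r)^\alpha$ and $\Theta^{*\alpha}(\mathcal{H}^\alpha,X,x)=\limsup_{r\downarrow0}\mathcal{H}^\alpha(X\cap\overline B_r(x))/(2r)^\alpha$. For $s\in\mathbb{S}^{n-1}$, $\epsilon>0$ the open double cone is $C_{s,\epsilon}(x)=\{y\in\mathbb{R}^n\setminus\{x\}:\min\{\measuredangle(y,x,x-s),\measuredangle(y,x,x+s)\}<\epsilon\}$, where $\measuredangle(y,x,z)$ is the angle at $x$. $X$ has an approximate $\alpha$-tangent at $x$ if there is $s\in\mathbb{S}^{n-1}$ such that $\lim_{r\downarrow0}\mathcal{H}^\alpha([X\setminus C_{s,\epsilon}(x)]\cap\overline B_r(x))/(2r)^\alpha=0$ for all $\epsilon>0$. $X$ has a weak approximate $\alpha$-tangent at $x$ if there are $\rho>0$ and a mapping $s:(0,\rho)\to\mathbb{S}^{n-1}$ such that $\lim_{r\downarrow0}\mathcal{H}^\alpha([X\setminus C_{s(r),\epsilon}(x)]\cap\overline B_r(x))/(2r)^\alpha=0$ for all $\epsilon>0$. (No positivity of densities is required in these definitions.) *)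

(* Defs.v *)
From HB Require Import structures.
From mathcomp Require Import all_boot all_order all_algebra.
From mathcomp Require Import all_classical all_reals all_analysis.
Import Order.TTheory GRing.Theory Num.Theory.
Import numFieldNormedType.Exports.

Set Implicit Arguments.
Unset Strict Implicit.
Unset Printing Implicit Defensive.

Local Open Scope classical_set_scope.
Local Open Scope ring_scope.

Section hausdorff.
Context {R : realType} {T : Type} (dist : T -> T -> R).
Local Open Scope ereal_scope.
Implicit Types (A B : set T) (F : (set T)^nat) (a delta : R).

(* [diam set0] is [-oo]; the case distinction in [diam_pow] makes the empty set
   contribute nothing to a covering sum, whatever the exponent. *)
Definition diam A : \bar R := ereal_sup [set (dist u v)%:E | u in A & v in A].

Definition diam_pow a A : \bar R := if A == set0 then 0 else diam A `^ a.

Definition delta_cover delta A : set ((set T)^nat) :=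
  [set F | A `<=` \bigcup_k F k /\ forall k, diam (F k) <= delta%:E].

Definition hausdorff_delta a delta A : \bar R :=
  ereal_inf [set \sum_(k <oo) diam_pow a (F k) | F in delta_cover delta A].

Definition hausdorff a A : \bar R :=
  ereal_sup [set hausdorff_delta a delta A | delta in [set delta | (0 < delta)%R]].

Lemma diam0 : diam set0 = -oo.
Proof.
by rewrite /diam (_ : [set _ | _ in _ & _ in _] = set0) ?ereal_sup0// -subset0
  => y [u []].
Qed.

Lemma diam_pow0 a : diam_pow a set0 = 0.
Proof. by rewrite /diam_pow eqxx. Qed.

Lemma diam_pow_ge0 a A : 0 <= diam_pow a A.
Proof. by rewrite /diam_pow; case: ifP => // _; exact: poweR_ge0. Qed.

Lemma hausdorff_delta_ge0 a delta A : 0 <= hausdorff_delta a delta A.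
Proof.
apply: le_ereal_inf_tmp => x [F _ <-]; apply: nneseries_ge0 => k _ _.
exact: diam_pow_ge0.
Qed.

Lemma hausdorff_delta_le a delta A : (0 < delta)%R ->
  hausdorff_delta a delta A <= hausdorff a A.
Proof. by move=> d0; apply: ereal_sup_ubound; exists delta. Qed.

Lemma hausdorff_ge0 a A : 0 <= hausdorff a A.
Proof.
exact: le_trans (hausdorff_delta_ge0 a 1 A) (hausdorff_delta_le a A ltr01).
Qed.

Lemma hausdorff0 a : hausdorff a set0 = 0.
Proof.
apply/eqP; rewrite eq_le hausdorff_ge0 andbT.
apply: ge_ereal_sup => _ [delta _ <-]; apply: ereal_inf_lbound.
exists (fun=> set0); first by split => // k; rewrite diam0 leNye.
by apply: eseries0 => k _ _; exact: diam_pow0.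
Qed.

Lemma le_hausdorff a : {homo hausdorff a : A B / A `<=` B >-> A <= B}.
Proof.
move=> A B AB; apply: ge_ereal_sup => _ [delta d0 <-].
apply: le_trans (hausdorff_delta_le a B d0).
apply: ereal_inf_le_tmp => _ [F [BF dF] <-]; exists F => //; split => //.
exact: subset_trans BF.
Qed.

Lemma hausdorff_delta_sigma_subadditive a delta :
  sigma_subadditive (hausdorff_delta a delta).
Proof.
move=> A; set h := hausdorff_delta a delta.
have h0 B : 0 <= h B by exact: hausdorff_delta_ge0.
have [[i ioo]|] := pselect (exists i, h (A i) = +oo).
  rewrite (eseries_pinfty _ _ ioo) ?leey// => n _.
  by rewrite -ltNye (lt_le_trans _ (h0 _)).
rewrite -forallNE => Aoo.
suff add2e (e : {posnum R}) :
    h (\bigcup_n A n) <= \sum_(i <oo) h (A i) + e%:num%:E.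
  by apply/lee_addgt0Pr => _/posnumP[].
rewrite (le_trans _ (epsilon_trick _ _ _))//.
pose P n (B : (set T)^nat) := delta_cover delta (A n) B /\
  \sum_(k <oo) diam_pow a (B k) <= h (A n) + (e%:num / (2 ^ n.+1)%:R)%:E.
have [G PG] : {G : ((set T)^nat)^nat & forall n, P n (G n)}.
  apply: (@choice _ _ P) => n; rewrite /P /h /hausdorff_delta.
  set S := (X in ereal_inf X); move infS : (ereal_inf S) => iS.
  case: iS infS => [r Sr|Soo|Soo].
  - have en1 : (0 < e%:num / (2 ^ n.+1)%:R)%R by [].
    have /(lb_ereal_inf_adherent en1) : ereal_inf S \is a fin_num by rewrite Sr.
    move=> [x [B cB muBx] xS].
    by exists B; split => //; rewrite muBx -Sr; exact/ltW.
  - by have := Aoo n; rewrite /h /hausdorff_delta Soo.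
  - by have := h0 (A n); rewrite /h /hausdorff_delta -/S Soo.
have g0 x : 0 <= (diam_pow a \o uncurry G) x by exact: diam_pow_ge0.
apply: (@le_trans _ _ (\esum_(i in setT) (diam_pow a \o uncurry G) i)).
  apply: ereal_inf_lbound => /=.
  have /card_esym/ppcard_eqP[f] := card_nat2.
  exists (uncurry G \o f).
    split => [t [i _ Ait]|k]; last first.
      by have [[_ /(_ (f k).2)]] := PG (f k).1; rewrite /=; case: (f k).
    have [j _ Gij] := (PG i).1.1 t Ait.
    by exists (f^-1%FUN (i, j)) => //=; rewrite invK ?inE.
  rewrite -(esum_pred_image (diam_pow a \o uncurry G) _ xpredT) ?[fun=> _]set_true//.
  by rewrite image_eq.
rewrite (_ : esum _ _ = \sum_(i <oo) \sum_(j <oo) diam_pow a (G i j)); last first.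
  pose J : nat -> set (nat * nat) := fun i => [set (i, j) | j in setT].
  rewrite (_ : setT = \bigcup_k J k); last first.
    by rewrite predeqE => -[x y]; split => // _; exists x => //; exists y.
  rewrite esum_bigcupT /=; last 2 first.
    - apply/trivIsetP => i j _ _ ij.
      rewrite predeqE => -[n m] /=; split => //= -[] [_] _ [<-{n} _].
      by move=> [m' _] [] /esym/eqP; rewrite (negbTE ij).
    - by move=> /= [n m]; exact: diam_pow_ge0.
  rewrite -(image_id [set: nat]) -fun_true esum_pred_image//; last first.
    by move=> n _; apply: esum_ge0 => *; exact: diam_pow_ge0.
  apply: eq_eseriesr => /= j _.
  rewrite -(esum_pred_image (diam_pow a \o uncurry G) (pair j) predT)//=; last 2 first.
    - by move=> *; exact: diam_pow_ge0.
    - by move=> ? ? _ _; exact: (@can_inj _ _ _ snd).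
  by congr esum; rewrite predeqE => -[x y]; split; move=> [i _ <-]; exists i.
apply: lee_nneseries => [i _ _|i _]; last exact: (PG i).2.
by apply: nneseries_ge0 => *; exact: diam_pow_ge0.
Qed.

Lemma hausdorff_sigma_subadditive a : sigma_subadditive (hausdorff a).
Proof.
move=> A; apply: ge_ereal_sup => _ [delta d0 <-].
apply: (le_trans (hausdorff_delta_sigma_subadditive _ _ _)).
apply: lee_nneseries => [i _ _|i _]; first exact: hausdorff_delta_ge0.
exact: hausdorff_delta_le.
Qed.

HB.instance Definition _ a := isOuterMeasure.Build R T (hausdorff a)
  (hausdorff0 a) (hausdorff_ge0 a) (@le_hausdorff a)
  (@hausdorff_sigma_subadditive a).

End hausdorff.

(* The canonical norm of ['rV[R]_n] is the sup norm, so the Euclidean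
   structure is spelled out. *)
Section euclidean.
Context {R : realType} {n : nat}.
Implicit Types (s u v x y z : 'rV[R]_n) (r e : R).

Definition dotp u v : R := \sum_(i < n) u ord0 i * v ord0 i.

Definition eucl_norm u : R := Num.sqrt (dotp u u).

Definition eucl_dist u v : R := eucl_norm (u - v).

Definition eucl_ball x r : set 'rV[R]_n := [set y | eucl_dist y x <= r].

Definition unit_sphere : set 'rV[R]_n := [set s | eucl_norm s = 1].

Definition angle y x z : R :=
  acos (dotp (y - x) (z - x) / (eucl_norm (y - x) * eucl_norm (z - x))).

Definition double_cone s e x : set 'rV[R]_n :=
  [set y | y != x /\ Num.min (angle y x (x - s)) (angle y x (x + s)) < e].

End euclidean.

Section curvature.
Context {R : realType} {n : nat} (X : set 'rV[R]_n).
Local Open Scope ereal_scope.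
Implicit Types u v w x y z : 'rV[R]_n.

Definition distinct3 x y z : bool := [&& x != y, y != z & z != x].

Definition circumradius x y z : \bar R :=
  let a := eucl_dist x y in let b := eucl_dist y z in let c := eucl_dist z x in
  let D := Num.sqrt ((a + b + c) * (a + b - c) * (a - b + c) * (- a + b + c)) in
  if (D == 0)%R then +oo else (a * b * c / D)%:E.

Definition thickness : \bar R :=
  ereal_inf [set r | exists u v w,
    [/\ X u, X v, X w, distinct3 u v w & r = circumradius u v w]].

(* On [\bar R], [0^-1 = +oo] and [+oo^-1 = 0]; moreover [ereal_inf set0 = +oo]. *)
Definition kappa x y z : \bar R :=
  if [&& x \in X, y \in X, z \in X & distinct3 x y z]
  then (circumradius x y z)^-1 else 0.

Definition kappa_i x y : \bar R :=
  if x == y then 0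
  else (ereal_inf [set circumradius x y w | w in X `\` [set x; y]])^-1.

Definition kappa_G x : \bar R :=
  (ereal_inf [set r | exists v w,
    [/\ X v, X w, distinct3 x v w & r = circumradius x v w]])^-1.

End curvature.

(* [hausdorff_on X a] is the Hausdorff measure of the metric space [X],
   transported along the inclusion of [X] in ['rV[R]_n]: [measurableType]s have
   to be nonempty, so [X] itself cannot carry the integrals.
   [caratheodory_hausdorff_on] shows that this does not affect measurability. *)
Section hausdorff_on.
Context {R : realType} {n : nat} (X : set 'rV[R]_n).
Local Open Scope ereal_scope.
Implicit Types (A : set 'rV[R]_n) (a : R).

Definition rdist (u v : X) : R := eucl_dist (val u) (val v).

Definition hausdorff_on a A : \bar R :=
  hausdorff rdist a [set u : X | A (val u)].

Lemma hausdorff_on0 a : hausdorff_on a set0 = 0.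
Proof. exact: hausdorff0. Qed.

Lemma hausdorff_on_ge0 a A : 0 <= hausdorff_on a A.
Proof. exact: hausdorff_ge0. Qed.

Lemma le_hausdorff_on a :
  {homo hausdorff_on a : A B / A `<=` B >-> A <= B}.
Proof. by move=> A B AB; apply: le_hausdorff => u /=; exact: AB. Qed.

Lemma hausdorff_on_sigma_subadditive a : sigma_subadditive (hausdorff_on a).
Proof.
move=> F; pose G k := [set u : X | F k (val u)].
have := @hausdorff_sigma_subadditive _ _ rdist a G.
by apply: le_trans; apply: le_hausdorff => u [k _ Fk]; exists k.
Qed.

HB.instance Definition _ a := isOuterMeasure.Build R 'rV[R]_n (hausdorff_on a)
  (hausdorff_on0 a) (hausdorff_on_ge0 a) (@le_hausdorff_on a)
  (@hausdorff_on_sigma_subadditive a).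

Lemma caratheodory_hausdorff_on a A :
  (hausdorff_on a).-caratheodory A <->
  (hausdorff rdist a).-caratheodory [set u : X | A (val u)].
Proof.
split=> mA B; last exact: mA.
have valB : [set u : X | (val @` B) (val u)] = B.
  apply/seteqP; split => [u [v Bv /val_inj <-]//|u Bu].
  by exists u.
by rewrite -valB; exact: (mA (val @` B)).
Qed.

Lemma diam_rdist (B : set X) : diam rdist B = diam eucl_dist (val @` B).
Proof.
congr ereal_sup; apply/seteqP; split => [_ [u Bu [v Bv <-]]|].
  by exists (val u); [exists u|exists (val v) => //; exists v].
move=> _ [_ [u Bu <-] [_ [v Bv <-] <-]].
by exists u => //; exists v.
Qed.

Lemma le_diam (A B : set 'rV[R]_n) : A `<=` B -> diam eucl_dist A <= diam eucl_dist B.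
Proof.
move=> AB; apply: ereal_sup_le => _ [u Au [v Av <-]].
by exists u; [exact: AB|exists v; [exact: AB|]].
Qed.

Lemma diam_pow_rdist a (B : set X) : diam_pow rdist a B = diam_pow eucl_dist a (val @` B).
Proof.
rewrite /diam_pow diam_rdist; congr (if _ then _ else _).
apply/eqP/eqP => [->|B0]; first by rewrite image_set0.
by rewrite -subset0 => u Bu; have : (val @` B) (val u); [exists u|rewrite B0].
Qed.

Lemma le_diam_pow a (A B : set 'rV[R]_n) : (0 <= a)%R ->
  A `<=` B -> diam_pow eucl_dist a A <= diam_pow eucl_dist a B.
Proof.
move=> a0 AB; rewrite /diam_pow; case: ifPn => [_|A0]; first exact: diam_pow_ge0.
have [u Au] : A !=set0 by exact/set0P.
rewrite ifF; last by apply/negbTE/set0P; exists u; exact: AB.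
have d0 C : C u -> 0 <= diam eucl_dist C.
  move=> Cu; apply: ereal_sup_ubound; exists u => //; exists u => //.
  rewrite /eucl_dist subrr /eucl_norm /dotp big1 ?sqrtr0// => i _.
  by rewrite mxE mul0r.
by apply: gt0_ler_poweR (le_diam AB) => //;
  rewrite in_itv/= leey andbT d0//; exact: AB.
Qed.

Lemma hausdorff_onE a A : (0 <= a)%R ->
  hausdorff_on a A = hausdorff eucl_dist a (A `&` X).
Proof.
move=> a0; congr ereal_sup; apply: eq_imagel => delta _.
apply/eqP; rewrite eq_le; apply/andP; split.
  apply: le_ereal_inf_tmp => _ [F [AF dF] <-].
  pose G k := [set u : X | F k (val u)].
  have GF k : val @` G k `<=` F k by move=> _ [u Fu <-].
  apply: (@le_trans _ _ (\sum_(k <oo) diam_pow rdist a (G k))).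
    apply: ereal_inf_lbound; exists G => //; split => [u Au|k].
      by have [k _ Fk] := AF (val u) (conj Au (set_mem (valP u))); exists k.
    by rewrite diam_rdist; exact: le_trans (le_diam (GF k)) (dF k).
  apply: lee_nneseries => [k _ _|k _]; first exact: diam_pow_ge0.
  by rewrite diam_pow_rdist; exact: le_diam_pow.
apply: le_ereal_inf_tmp => _ [F [AF dF] <-].
apply: ereal_inf_lbound; exists (fun k => val @` F k).
  split => [u [Au Xu]|k]; last by rewrite -diam_rdist.
  have [k _ Fk] := AF (exist _ u (mem_set Xu) : X) Au.
  by exists k => //; exists (exist _ u (mem_set Xu)).
by apply: eq_eseriesr => k _; rewrite diam_pow_rdist.
Qed.

End hausdorff_on.

Section energies.
Context {R : realType} {n : nat} (X : set 'rV[R]_n) (a p : R).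
Local Open Scope ereal_scope.

Let mu : set (caratheodory_type (hausdorff_on X a)) -> \bar R :=
  hausdorff_on X a.

Definition integral_on (f : 'rV[R]_n -> \bar R) : \bar R :=
  \int[mu]_(x in X) f x.

Definition energy_U : \bar R := integral_on (fun x => kappa_G X x `^ p).

Definition energy_I : \bar R :=
  integral_on (fun y => integral_on (fun x => kappa_i X x y `^ p)).

Definition energy_M : \bar R :=
  integral_on (fun z => integral_on (fun y => integral_on (fun x =>
    kappa X x y z `^ p))).

End energies.

Section densities.
Context {R : realType} {n : nat} (a : R) (X : set 'rV[R]_n) (x : 'rV[R]_n).
Local Open Scope ereal_scope.

Definition density_ratio (A : set 'rV[R]_n) (r : R) : \bar R :=
  hausdorff eucl_dist a (A `&` eucl_ball x r) / ((2 * r) `^ a)%:E.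

Definition lower_density : \bar R := limf_einf (density_ratio X) (0%R : R)^'+.

Definition upper_density : \bar R := limf_esup (density_ratio X) (0%R : R)^'+.

Definition approx_tangent : Prop :=
  exists s : 'rV[R]_n, unit_sphere s /\
    forall e : R, (0 < e)%R ->
      density_ratio (X `\` double_cone s e x) r @[r --> (0%R : R)^'+] --> 0.

(* Only the values of [s] on the interval (0, rho) matter. *)
Definition weak_approx_tangent : Prop :=
  exists (rho : R) (s : R -> 'rV[R]_n),
    [/\ (0 < rho)%R,
        forall r : R, (0 < r < rho)%R -> unit_sphere (s r) &
        forall e : R, (0 < e)%R ->
          density_ratio (X `\` double_cone (s r) e x) r @[r --> (0%R : R)^'+] --> 0].

End densities.

(* Main.v *)
(* Three points [y, v, w] have [1 / r(y, v, w)] equal to twice the area of the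
   parallelogram on [y - w, v - w] over the product of the side lengths (Heron).  Hence if the
   directions of [y, v] from [x] stay away from each other as lines, at mutual angle
   at least [theta], and [w] is much closer to [x] than [y] and [v], then
   [1 / r(y, v, w) >= c(theta) / max(|y - x|, |v - x|)].

   Either the directions of the points of [X] near [x] cluster at a single line,
   which is then a tangent in the strong sense that [X] minus the cone is empty near
   [x], or there are arbitrarily close pairs with separated directions, and then
   [kappa_G X y >= c / |y - x|] for every [y] in [X].  If [X] has no (weak)
   approximate tangent, then for arbitrarily small [r] a portion [c r ^ alpha] of
   [X] in the ball of radius [r] lies outside every double cone of a fixed opening.
   In all cases the outermost integrand of the energy is at least
   [c r ^ (k alpha - p)] on the ball of radius [r] ([k = 0, 1, 2] for U, I, M), where
   [p - k alpha >= alpha], while the ball has mass at least [c r ^ alpha]; summing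
   over disjoint annuli the energy is infinite.

   Only lower bounds of integrals are needed, and [integral_on] is a supremum over
   measurable simple functions, so the integrands need not be measurable. *)
Require Import Defs.
From mathcomp Require Import all_boot all_order all_algebra.
From mathcomp Require Import all_classical all_reals all_analysis.
From mathcomp Require Import measurable_realfun ring lra.
Import Order.TTheory GRing.Theory Num.Theory.
Import numFieldNormedType.Exports.
Local Open Scope classical_set_scope.
Local Open Scope ring_scope.
Local Open Scope ereal_scope.

Set Implicit Arguments.
Unset Strict Implicit.
Unset Printing Implicit Defensive.

(** * Circumradii and Gram determinants *)

Section euclidean_facts.
Context {R : realType} {n : nat}.
Implicit Types (u v w x y z s h : 'rV[R]_n) (t : R).
Local Open Scope ring_scope.

Lemma dotpC u v : dotp u v = dotp v u.
Proof. by apply: eq_bigr => i _; rewrite mulrC. Qed.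

Lemma dotpDl u v w : dotp (u + v) w = dotp u w + dotp v w.
Proof. by rewrite -big_split; apply: eq_bigr => i _; rewrite mxE mulrDl. Qed.

Lemma dotpZl t u v : dotp (t *: u) v = t * dotp u v.
Proof. by rewrite /dotp mulr_sumr; apply: eq_bigr => i _; rewrite mxE mulrA. Qed.

Lemma dotpNl u v : dotp (- u) v = - dotp u v.
Proof. by rewrite -scaleN1r dotpZl mulN1r. Qed.

Lemma dotpBl u v w : dotp (u - v) w = dotp u w - dotp v w.
Proof. by rewrite dotpDl dotpNl. Qed.

Lemma dotpBr u v w : dotp w (u - v) = dotp w u - dotp w v.
Proof. by rewrite dotpC dotpBl !(dotpC w). Qed.

Lemma dotpZr t u v : dotp u (t *: v) = t * dotp u v.
Proof. by rewrite dotpC dotpZl dotpC. Qed.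

Lemma dotp_ge0 u : 0 <= dotp u u.
Proof. by apply: sumr_ge0 => i _; rewrite -expr2 sqr_ge0. Qed.

Lemma dotp_eq0 u : (dotp u u == 0) = (u == 0).
Proof.
apply/idP/eqP => [|->]; last by rewrite /dotp big1// => i _; rewrite mxE mul0r.
rewrite psumr_eq0 => [/allP u0|i _]; last by rewrite -expr2 sqr_ge0.
apply/rowP => i; rewrite mxE; apply/eqP.
by have := u0 i (mem_index_enum i); rewrite /= -expr2 sqrf_eq0.
Qed.

Lemma eucl_norm_ge0 u : 0 <= eucl_norm u.
Proof. exact: sqrtr_ge0. Qed.

Lemma sqr_eucl_norm u : eucl_norm u ^+ 2 = dotp u u.
Proof. by rewrite sqr_sqrtr// dotp_ge0. Qed.

Lemma eucl_norm_eq0 u : (eucl_norm u == 0) = (u == 0).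
Proof. by rewrite -sqrf_eq0 sqr_eucl_norm dotp_eq0. Qed.

Lemma eucl_norm_gt0 u : (0 < eucl_norm u) = (u != 0).
Proof. by rewrite lt0r eucl_norm_ge0 andbT eucl_norm_eq0. Qed.

Lemma eucl_normZ t u : eucl_norm (t *: u) = `|t| * eucl_norm u.
Proof.
by rewrite /eucl_norm dotpZl dotpZr mulrA -expr2 sqrtrM ?sqr_ge0// sqrtr_sqr.
Qed.

Lemma eucl_normN u : eucl_norm (- u) = eucl_norm u.
Proof. by rewrite -scaleN1r eucl_normZ normrN1 mul1r. Qed.

(** The squared area of the parallelogram on [u] and [v]; for unit vectors, the squared sine of
    their angle. *)
Definition gram u v := dotp u u * dotp v v - dotp u v ^+ 2.

Lemma gramC u v : gram u v = gram v u.
Proof. by rewrite /gram (dotpC u v) mulrC. Qed.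

Lemma gramZ t u v : gram u (t *: v) = t ^+ 2 * gram u v.
Proof. by rewrite /gram !dotpZl !dotpZr; ring. Qed.

Lemma gram_ge0 u v : 0 <= gram u v.
Proof.
have [->|v0] := eqVneq v 0.
  by rewrite -(scale0r (0 : 'rV[R]_n)) gramZ expr0n mul0r.
have vv : 0 < dotp v v by rewrite lt0r dotp_eq0 v0 dotp_ge0.
rewrite -(pmulr_rge0 _ vv).
(* Up to the factor [dotp v v], this vector is the component of [u] orthogonal to [v]. *)
suff -> : dotp v v * gram u v = dotp (dotp v v *: u - dotp u v *: v)
    (dotp v v *: u - dotp u v *: v) by exact: dotp_ge0.
by rewrite /gram !(dotpBl, dotpBr, dotpZl, dotpZr) (dotpC v u); ring.
Qed.

Lemma norm_dotp_le u v : `|dotp u v| <= eucl_norm u * eucl_norm v.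
Proof.
rewrite -ler_sqr ?nnegrE ?mulr_ge0 ?eucl_norm_ge0// real_normK ?num_real//.
by rewrite exprMn !sqr_eucl_norm -subr_ge0 gram_ge0.
Qed.

Lemma eucl_normD u v : eucl_norm (u + v) <= eucl_norm u + eucl_norm v.
Proof.
rewrite -ler_sqr ?nnegrE ?addr_ge0 ?eucl_norm_ge0// sqrrD !sqr_eucl_norm.
rewrite dotpDl !(dotpC _ (u + v)) !dotpDl (dotpC v u).
by have := norm_dotp_le u v; have := ler_norm (dotp u v); lra.
Qed.

Lemma eucl_normB u v : eucl_norm (u - v) <= eucl_norm u + eucl_norm v.
Proof. by rewrite -(eucl_normN v) eucl_normD. Qed.

Lemma eucl_distC u v : eucl_dist u v = eucl_dist v u.
Proof. by rewrite /eucl_dist -eucl_normN opprB. Qed.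

Lemma eucl_dist_gt0 u v : (0 < eucl_dist u v) = (u != v).
Proof. by rewrite /eucl_dist eucl_norm_gt0 subr_eq0. Qed.

Lemma eucl_distxx u : eucl_dist u u = 0.
Proof. by apply/eqP; rewrite eucl_norm_eq0 subrr. Qed.

Lemma eucl_dist_ge0 u v : 0 <= eucl_dist u v.
Proof. exact: eucl_norm_ge0. Qed.

Lemma eucl_dist_triangle v u w : eucl_dist u w <= eucl_dist u v + eucl_dist v w.
Proof. by rewrite /eucl_dist -[u - w](subrKA v) eucl_normD. Qed.

Lemma eucl_norm_lip u v : `|eucl_norm u - eucl_norm v| <= eucl_dist u v.
Proof.
rewrite ler_norml; apply/andP; split.
  have := eucl_normB u (u - v); rewrite subKr /eucl_dist; lra.
by have := eucl_normD (u - v) v; rewrite subrK /eucl_dist; lra.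
Qed.

Lemma eucl_norm_le u : eucl_norm u <= n%:R * `|u|.
Proof.
rewrite -ler_sqr ?nnegrE ?eucl_norm_ge0 ?mulr_ge0// sqr_eucl_norm.
apply: (@le_trans _ _ (\sum_(i < n) `|u| ^+ 2)).
  apply: ler_sum => i _; rewrite -expr2 -real_normK ?num_real// ler_sqr ?nnegrE//.
  by rewrite /Num.norm/= mx_normrE; apply: le_bigmax (ord0, i).
rewrite sumr_const card_ord exprMn -[leLHS]mulr_natl.
apply: ler_wpM2r; first exact: sqr_ge0.
by rewrite -natrX ler_nat -{1}(expn1 n); case: (n) => // k; rewrite leq_pexp2l.
Qed.

(** The shear [gram a b = gram a (a - b)] replaces [v] by the side [u - v], which translation by [h]
    leaves fixed. Only the first vector moves, so the loss carries the factor [|u - v|^2]. *)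
Lemma gram_translate u v h :
  gram u v - 4 * eucl_norm u * eucl_norm h * eucl_norm (u - v) ^+ 2
    <= gram (u - h) (v - h).
Proof.
have shear a b : gram a b = gram a (a - b).
  by rewrite /gram !(dotpBl, dotpBr) (dotpC b a); ring.
rewrite (shear u v) (shear (u - h)) opprB addrA subrK; set d := u - v.
have -> : gram (u - h) d = gram u d + gram h d
    - 2 * (dotp u h * dotp d d - dotp u d * dotp h d).
  by rewrite /gram !(dotpBl, dotpBr) (dotpC h u); ring.
have := gram_ge0 h d; suff : dotp u h * dotp d d - dotp u d * dotp h d <=
  2 * (eucl_norm u * eucl_norm h * eucl_norm d ^+ 2) by lra.
apply: le_trans (ler_norm _) _; apply: le_trans (ler_normB _ _) _.
rewrite mulr_natl mulr2n lerD// normrM.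
  by rewrite sqr_eucl_norm (ger0_norm (dotp_ge0 d)) ler_wpM2r ?dotp_ge0 ?norm_dotp_le.
apply: le_trans (ler_pM _ _ (norm_dotp_le u d) (norm_dotp_le h d)) _ => //.
by rewrite expr2 mulrACA.
Qed.

(* The sine addition formula, in the form
   [sin (a + b) ^+ 2 <= 2 * (sin a ^+ 2 + sin b ^+ 2)]. *)
Lemma gram_triangle s v w : eucl_norm s = 1 -> eucl_norm v = 1 -> eucl_norm w = 1 ->
  gram v w <= 2 * (gram s v + gram s w).
Proof.
move=> s1 v1 w1.
have ss : dotp s s = 1 by rewrite -sqr_eucl_norm s1 expr1n.
have vv : dotp v v = 1 by rewrite -sqr_eucl_norm v1 expr1n.
have ww : dotp w w = 1 by rewrite -sqr_eucl_norm w1 expr1n.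
(* Cauchy-Schwarz for the components of [v] and [w] orthogonal to [s]. *)
have := gram_ge0 (v - dotp s v *: s) (w - dotp s w *: s).
rewrite /gram !(dotpBl, dotpBr, dotpZl, dotpZr) (dotpC v s) (dotpC w s) ss vv ww.
set a := dotp s v; set b := dotp s w; set c := dotp v w => H.
have : (c - a * b) ^+ 2 <= (1 - a ^+ 2) * (1 - b ^+ 2).
  rewrite -subr_ge0; apply: le_trans H _.
  by rewrite le_eqVlt; apply/orP; left; apply/eqP; ring.
have a1 : a ^+ 2 <= 1.
  by have := gram_ge0 s v; rewrite /gram ss vv -/a; lra.
have b1 : b ^+ 2 <= 1.
  by have := gram_ge0 s w; rewrite /gram ss ww -/b; lra.
have ab1 : `|a * b| <= 1.
  by rewrite -ler_sqr ?nnegrE// expr1n real_normK ?num_real// exprMn; nra.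
move: ab1; rewrite ler_norml => /andP[ab1 ab2].
(* [A] and [B] are [gram s v] and [gram s w]. AM-GM bounds [|e|] by their mean, and
   [1 - c^2 = A + B - AB - e^2 - 2abe] with [|ab| <= 1] gives the claim. *)
set A := 1 - a ^+ 2; set B := 1 - b ^+ 2; set e := c - a * b => H2.
have e2 : `|e| <= (A + B) / 2.
  rewrite -ler_sqr ?nnegrE// ?real_normK ?num_real//; last by rewrite /A /B; lra.
  apply: le_trans H2 _; rewrite -subr_ge0.
  by rewrite (_ : _ - _ = ((A - B) / 2) ^+ 2) ?sqr_ge0//; field.
move: e2; rewrite ler_norml => /andP[e2 e3].
have -> : c = e + a * b by rewrite /e subrK.
have : - (2 * (a * b) * e) <= A + B by nra.
have A0 : 0 <= A by rewrite subr_ge0.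
have B0 : 0 <= B by rewrite subr_ge0.
have := mulr_ge0 A0 B0; have := sqr_ge0 e.
by rewrite /A /B; clear; nra.
Qed.

(** On unit vectors [gram s v] is [1 - (dotp s v)^2]; the difference of squares factors, and the sum
    factor is at most 2. *)
Lemma gram_lip s v w : eucl_norm s = 1 -> eucl_norm v = 1 -> eucl_norm w = 1 ->
  gram s v <= gram s w + 2 * eucl_dist v w.
Proof.
move=> s1 v1 w1; rewrite /gram -!sqr_eucl_norm s1 v1 w1.
have := norm_dotp_le s (w - v).
have := norm_dotp_le s (w + v); have := eucl_normD w v.
rewrite -[eucl_norm (w - v)]/(eucl_dist w v) eucl_distC s1 !mul1r v1 w1.
move=> wv1 wv2 wv3.
suff : `|dotp s w ^+ 2 - dotp s v ^+ 2| <= 2 * eucl_dist v w.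
  by move=> /(le_trans (ler_norm _)); lra.
rewrite subr_sqr normrM mulrC ler_pM//; last by rewrite -dotpBr.
by rewrite -(dotpC w) -(dotpC v) -dotpDl dotpC; apply: le_trans wv2 wv1.
Qed.

(** The left side is 16 times the squared area of the triangle and [gram] is 4 times it; the law of
    cosines expresses the inner product by side lengths. *)
Lemma heron y v w : let a := eucl_dist y v in let b := eucl_dist v w in
  let c := eucl_dist w y in
  (a + b + c) * (a + b - c) * (a - b + c) * (- a + b + c) =
  4 * gram (y - w) (v - w).
Proof.
move=> a b c.
have a2 : a ^+ 2 = dotp (y - w) (y - w) + dotp (v - w) (v - w)
    - 2 * dotp (y - w) (v - w).
  rewrite /a /eucl_dist -[y - v](subrKA w) -(opprB v w) sqr_eucl_norm.
  by rewrite !(dotpBl, dotpBr) (dotpC v w) (dotpC y w) (dotpC y v); ring.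
have b2 : b ^+ 2 = dotp (v - w) (v - w) by rewrite sqr_eucl_norm.
have c2 : c ^+ 2 = dotp (y - w) (y - w) by rewrite /c eucl_distC sqr_eucl_norm.
rewrite /gram -b2 -c2.
have -> : dotp (y - w) (v - w) = (c ^+ 2 + b ^+ 2 - a ^+ 2) / 2.
  by rewrite a2 b2 c2; field.
by field.
Qed.

(** Squaring avoids the root in Heron's formula. Since [t > 0] and the sides are positive, the
    hypothesis forces a positive [gram], which excludes the collinear branch. *)
Lemma circumradius_le t y v w : 0 < t -> distinct3 y v w ->
  t ^+ 2 * (eucl_dist y v * eucl_dist v w * eucl_dist w y) ^+ 2
    <= 4 * gram (y - w) (v - w) ->
  (t%:E <= (circumradius y v w)^-1)%E.
Proof.
move=> t0 /and3P[yv vw wy] tD; rewrite /circumradius/= heron.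
set abc := eucl_dist y v * _ * _ in tD *.
have abc0 : 0 < abc by rewrite !mulr_gt0 ?eucl_dist_gt0.
have ta0 : 0 <= t * abc by rewrite mulr_ge0 ?ltW.
have D0 : t * abc <= Num.sqrt (4 * gram (y - w) (v - w)).
  rewrite -ler_sqr ?nnegrE ?sqrtr_ge0//.
  by rewrite exprMn sqr_sqrtr ?mulr_ge0 ?gram_ge0.
have D1 : 0 < Num.sqrt (4 * gram (y - w) (v - w)).
  by apply: lt_le_trans D0; rewrite mulr_gt0.
rewrite gt_eqF// inver gt_eqF ?divr_gt0// lee_fin invf_div ler_pdivlMr//.
Qed.

End euclidean_facts.

(** * Directions at a point *)

Section geometry.
Context {R : realType} {n : nat}.
Implicit Types (u v w x y z s h : 'rV[R]_n) (t r e : R) (X : set 'rV[R]_n).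
Local Open Scope ring_scope.

Definition normalize u := (eucl_norm u)^-1 *: u.

Lemma eucl_norm_normalize u : u != 0 -> eucl_norm (normalize u) = 1.
Proof.
move=> u0; rewrite eucl_normZ ger0_norm ?invr_ge0 ?eucl_norm_ge0//.
by rewrite mulVf// eucl_norm_eq0.
Qed.

Lemma gram_normalizer u v : v != 0 ->
  gram u v = eucl_norm v ^+ 2 * gram u (normalize v).
Proof.
by move=> v0; rewrite gramZ mulrA -exprMn divff ?eucl_norm_eq0// expr1n mul1r.
Qed.

Lemma gram_normalize u v : u != 0 -> v != 0 ->
  gram u v = (eucl_norm u * eucl_norm v) ^+ 2 * gram (normalize u) (normalize v).
Proof.
move=> u0 v0; rewrite (gram_normalizer u v0) gramC (gram_normalizer _ u0).
by rewrite mulrA exprMn (mulrC (eucl_norm u ^+ 2)) (gramC (normalize v)).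
Qed.

(* The points of the complement of a double cone with apex [x] and axis [s];
   [t] is the squared sine of the opening angle. *)
Definition wide x s t : set 'rV[R]_n :=
  [set y | t * (eucl_norm (y - x) * eucl_norm s) ^+ 2 <= gram (y - x) s].

Lemma wide_normalize x s t : s != 0 -> wide x (normalize s) t = wide x s t.
Proof.
move=> s0; apply/funext => y; apply/propext; rewrite /wide/=.
rewrite eucl_norm_normalize// mulr1 (gram_normalizer _ s0) exprMn.
rewrite (mulrA t (_ ^+ 2)) (mulrC (eucl_norm s ^+ 2)).
by rewrite ler_pM2r// exprn_gt0// eucl_norm_gt0.
Qed.

Lemma subset_wide x s t t' : t' <= t -> wide x s t `<=` wide x s t'.
Proof. by move=> tt y; apply: le_trans; rewrite ler_wpM2r ?sqr_ge0. Qed.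

(** Take [t] to be the squared sine of [e'], where [e' = min(e, 1/2)] stays below [pi / 2]. Then
    [cos e'] is nonnegative, and the bound on the cosine of the angle with the axis, valid for both
    signs, can be squared. *)
Lemma setC_double_cone_wide e : 0 < e ->
  exists2 t, 0 < t <= 1 & forall x s, unit_sphere s ->
    ~` double_cone s e x `<=` wide x s t.
Proof.
move=> e0; set e' := Num.min e (1 / 2).
have e'0 : 0 < e' by rewrite lt_min e0 divr_gt0.
have pi1 : 1 / 2 < pi / 2 :> R by have := @pihalf_ge1 R; lra.
have e'pi : e' < pi / 2 by rewrite gt_min pi1 orbT.
have ce0 : 0 <= cos e' by rewrite cos_ge0_pihalf// ltW ?e'pi//=; lra.
have ce1 : cos e' < 1.
  rewrite -(@cos0 R) ltr_cos// in_itv/= ?lexx ?pi_ge0//; apply/andP; split; lra.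
exists (1 - cos e' ^+ 2) => [|x s s1 y].
  by rewrite gerBl sqr_ge0 andbT subr_gt0 expr_lt1.
rewrite /double_cone/wide/= => /not_andP yC.
have [->|yx] := eqVneq y x.
  rewrite -[eucl_norm (x - x)]/(eucl_dist x x) eucl_distxx.
  by rewrite mul0r expr0n mulr0 gram_ge0.
have {yC} : e' <= Num.min (angle y x (x - s)) (angle y x (x + s)).
  by rewrite ge_min; apply/orP; left; rewrite leNgt; apply/negP; case: yC.
rewrite /angle (addrC x (- s)) (addrC x s) !addrK.
have u0 : 0 < eucl_norm (y - x) by rewrite eucl_norm_gt0 subr_eq0.
move: s1; rewrite /unit_sphere/= => s1.
rewrite eucl_normN s1 !mulr1 dotpC dotpNl -(dotpC (y - x)) mulNr.
set q := dotp (y - x) s / _.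
have : `|q| <= 1.
  rewrite normrM normfV (gtr0_norm u0) ler_pdivrMr// mul1r.
  by apply: le_trans (norm_dotp_le _ _) _; rewrite s1 mulr1.
rewrite ler_norml => /andP[q0 q1].
have cosq p : -1 <= p -> p <= 1 -> e' <= acos p -> p <= cos e'.
  move=> p0 p1 ep; have pI : -1 <= p <= 1 by rewrite p0.
  have ppi : acos p \in `[0, pi] by rewrite in_itv/= acos_ge0// acos_lepi.
  have epi : e' \in `[0, pi] by rewrite in_itv/=; apply/andP; split; lra.
  by rewrite -[leLHS]acosK ?in_itv//= leNgt ltr_cos// -leNgt.
rewrite le_min => /andP[/cosq c1 /cosq c2].
have {}c1 : - q <= cos e' by apply: c1; lra.
have {}c2 : q <= cos e' by apply: c2; lra.
have -> : gram (y - x) s = eucl_norm (y - x) ^+ 2 * (1 - q ^+ 2).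
  rewrite /gram -!sqr_eucl_norm s1 /q; field; rewrite gt_eqF//.
rewrite mulrC ler_wpM2l ?sqr_ge0// lerD2l lerN2.
rewrite -[leLHS]real_normK ?num_real// ler_sqr ?nnegrE//.
by rewrite ler_norml; apply/andP; split; lra.
Qed.

(** The last hypothesis makes [gram_translate], with [h = w - x], lose at most half of
    [t * (a * b)^2]. The sides are at most [2r], [2b] and [2a], so [a * b] cancels against the area
    and only [r] survives. *)
Lemma inv_circumradius_ge x y v w t r : 0 < t -> 0 < r ->
  y != x -> v != x -> eucl_dist y x <= r -> eucl_dist v x <= r ->
  eucl_dist w x < eucl_dist y x -> eucl_dist w x < eucl_dist v x ->
  wide x (v - x) t y ->
  8 * eucl_dist y x * eucl_dist w x * eucl_dist y v ^+ 2
    <= t * (eucl_dist y x * eucl_dist v x) ^+ 2 ->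
  distinct3 y v w /\
  ((Num.sqrt t / 8 / r)%:E <= (circumradius y v w)^-1)%E.
Proof.
move=> t0 r0 yx vx yr vr wy wv; rewrite /wide/= => tg h8.
set a := eucl_dist y x in yr wy h8 *; set b := eucl_dist v x in vr wv h8 *.
set h := eucl_dist w x in wy wv h8.
have a0 : 0 < a by rewrite eucl_dist_gt0.
have b0 : 0 < b by rewrite eucl_dist_gt0.
have yv : y != v.
  apply/eqP => yv; move: tg; rewrite yv /gram -expr2 subrr; apply/negP.
  by rewrite -ltNge !mulr_gt0// exprn_gt0// mulr_gt0.
have yw : w != y by apply/eqP => E; move: wy; rewrite /h E ltxx.
have vw : v != w by apply/eqP => E; move: wv; rewrite /b E ltxx.
have D : distinct3 y v w by rewrite /distinct3 yv vw yw.
split=> //; apply: circumradius_le => //; first by rewrite !divr_gt0// sqrtr_gt0.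
have := gram_translate (y - x) (v - x) (w - x).
have BB (p q : 'rV[R]_n) : p - x - (q - x) = p - q by rewrite opprB addrA subrK.
rewrite !BB -[eucl_norm (y - v)]/(eucl_dist y v) => g1.
have g2 : t / 2 * (a * b) ^+ 2 <= gram (y - w) (v - w).
  apply: le_trans g1; rewrite -[eucl_norm (y - x)]/a -[eucl_norm (w - x)]/h.
  have : t * (a * b) ^+ 2 <= gram (y - x) (v - x) by [].
  move: h8; lra.
have d1 : eucl_dist y v <= 2 * r.
  have := eucl_dist_triangle x y v; rewrite (eucl_distC x v) -/a -/b; lra.
have d2 : eucl_dist v w <= 2 * b.
  have := eucl_dist_triangle x v w; rewrite (eucl_distC x w) -/h -/b; lra.
have d3 : eucl_dist w y <= 2 * a.
  have := eucl_dist_triangle x w y; rewrite (eucl_distC x y) -/h -/a; lra.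
apply: (@le_trans _ _ (t * (a * b) ^+ 2)); last first.
  have : 0 <= t * (a * b) ^+ 2 by rewrite mulr_ge0 ?sqr_ge0 ?ltW.
  by move: g2; lra.
rewrite [X in X <= _](_ : _ = t * ((eucl_dist y v * eucl_dist v w * eucl_dist w y)
    / (8 * r)) ^+ 2); last first.
  rewrite !exprMn sqr_sqrtr ?ltW// !exprVn; field; by rewrite gt_eqF.
apply: ler_wpM2l; first exact: ltW.
have [d10 d20 d30] :=
  And3 (eucl_dist_ge0 y v) (eucl_dist_ge0 v w) (eucl_dist_ge0 w y).
have r80 : 0 < 8 * r by rewrite mulr_gt0.
rewrite ler_sqr ?nnegrE ?divr_ge0 ?mulr_ge0 ?(ltW a0) ?(ltW b0) ?(ltW r0)//.
rewrite ler_pdivrMr//.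
apply: (@le_trans _ _ (2 * r * (2 * b) * (2 * a))); last by lra.
by rewrite !ler_pM ?mulr_ge0.
Qed.

Definition limit_pt X x := forall r, 0 < r ->
  exists2 w, X w & 0 < eucl_dist w x <= r.

Lemma limit_pt_inv_circumradius_ge X x y v t r : limit_pt X x ->
  0 < t -> 0 < r -> y != x -> v != x ->
  eucl_dist y x <= r -> eucl_dist v x <= r -> wide x (v - x) t y ->
  exists w, [/\ X w, distinct3 y v w &
    ((Num.sqrt t / 8 / r)%:E <= (circumradius y v w)^-1)%E].
Proof.
move=> accX t0 r0 yx vx yr vr yv.
set a := eucl_dist y x; set b := eucl_dist v x; set d := eucl_dist y v.
have a0 : 0 < a by rewrite eucl_dist_gt0.
have b0 : 0 < b by rewrite eucl_dist_gt0.
have d0 : 0 <= d by exact: eucl_dist_ge0.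
(* The halves put [w] strictly closer to [x] than [y] and [v]; the last term is the smallness
   required by [inv_circumradius_ge], with [+ 1] keeping the denominator positive. *)
set h := Num.min (Num.min (a / 2) (b / 2)) (t * (a * b) ^+ 2 / (8 * a * (d ^+ 2 + 1))).
have d21 : 0 < d ^+ 2 + 1 by rewrite ltr_wpDl// sqr_ge0.
have h0 : 0 < h.
  by rewrite !lt_min !divr_gt0 ?mulr_gt0 ?exprn_gt0 ?mulr_gt0.
have [w Xw /andP[w0 wh]] := accX _ h0.
have : eucl_dist w x <= h by [].
rewrite !le_min -andbA => /and3P[wa wb]; rewrite ler_pdivlMr ?mulr_gt0// => wt.
have [|||D1 D2] := @inv_circumradius_ge x y v w t r t0 r0 yx vx yr vr _ _ yv.
- by apply: le_lt_trans wa _; rewrite -/a; lra.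
- by apply: le_lt_trans wb _; rewrite -/b; lra.
- apply: le_trans wt; rewrite -/a -/d (mulrAC (8 * a)) mulrC.
  by rewrite ler_wpM2l ?eucl_dist_ge0// ler_wpM2l ?mulr_ge0 ?(ltW a0)// lerDl.
by exists w.
Qed.


(* Pairs of points of [X] near [x] whose directions from [x] differ by an angle
   of squared sine at least [t]. *)
Definition spread X x t := forall r, 0 < r -> exists v w,
  [/\ X v, X w, 0 < eucl_dist v x <= r, 0 < eucl_dist w x <= r &
      wide x (w - x) t v].

(** The bound is [[set x]] rather than the empty set because [x] lies in every [wide x s t]. *)
Definition tangent_line X x s := forall t, 0 < t -> exists2 r, 0 < r &
  X `&` eucl_ball x r `&` wide x s t `<=` [set x].

Lemma exists_unit_sphere : (0 < n)%N -> exists s : 'rV[R]_n, unit_sphere s.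
Proof.
move=> n0; have u0 : (const_mx 1 : 'rV[R]_n) != 0.
  by apply/eqP => /rowP/(_ (Ordinal n0)); rewrite !mxE => /eqP; rewrite oner_eq0.
by exists (normalize (const_mx 1)); exact: eucl_norm_normalize.
Qed.

Lemma compact_unit_sphere : compact (@unit_sphere R n).
Proof.
apply: bounded_closed_compact.
  exists 1; split => // M M1 u; rewrite /unit_sphere/= => u1.
  apply: le_trans (ltW M1); rewrite {1}/Num.norm/= mx_normrE.
  apply: bigmax_le => // -[i j] _ /=; rewrite ord1.
  rewrite -ler_sqr ?nnegrE// real_normK ?num_real// -u1 sqr_eucl_norm expr2.
  by rewrite /dotp (bigD1 j)//= lerDl sumr_ge0// => k _; rewrite -expr2 sqr_ge0.
rewrite (_ : unit_sphere = (fun u : 'rV[R]_n => dotp u u) @^-1` [set 1]); last first.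
  apply/seteqP; split => u; rewrite /unit_sphere/= -sqr_eucl_norm.
    by move=> ->; rewrite expr1n.
  by move=> /eqP; rewrite sqrp_eq1 ?eucl_norm_ge0// => /eqP.
apply: closed_comp; last exact: closed_eq.
move=> u _; apply: continuous_big => [|i _ {}u]; first exact: add_continuous.
have ui : continuous (fun v : 'rV[R]_n => v ord0 i) by exact: coord_continuous.
exact: cvgM (ui u) (ui u).
Qed.

(** The directions of points of [X] in shrinking balls generate a filter on the compact sphere,
    which has a cluster point [s]. Without spread, directions at small scales are all close to each
    other, hence to [s]. *)
Lemma spread_or_tangent_line X x : (0 < n)%N ->
  (exists2 t, 0 < t & spread X x t) \/
  (exists2 s, unit_sphere s & tangent_line X x s).
Proof.
move=> n0; have [[t t0 Xt]|nspread] := pselect (exists2 t, 0 < t & spread X x t).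
  by left; exists t.
(* If [x] is not a limit point, [X] has at most the point [x] near [x], and any unit vector
   serves. *)
right; have [accX|/existsNP[r /not_implyP[r0 /forall2NP Xr]]] :=
    pselect (limit_pt X x); last first.
  have [s s1] := exists_unit_sphere n0; exists s => // t t0.
  exists r => // y [[Xy yr] _]; have [//|/negP] := Xr y.
  rewrite negb_and -leNgt => /orP[|]; last by rewrite -ltNge ltNge yr.
  by rewrite leNgt eucl_dist_gt0 negbK => /eqP.
pose dirs r := [set normalize (v - x) | v in X `&` [set v | 0 < eucl_dist v x <= r]].
pose F := filter_from [set r : R | 0 < r] dirs.
have FF : ProperFilter F.
  apply: filter_from_proper => [|r r0]; last first.
    by have [v Xv vr] := accX r r0; exists (normalize (v - x)), v.
  apply: filter_from_filter; first by exists 1; exact: ltr01.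
  move=> r1 r2 r10 r20; exists (Num.min r1 r2); first by rewrite /= lt_min r10.
  move=> u [v [Xv /=]]; rewrite le_min => /and3P[v0 vr1 vr2] <-.
  by split; exists v => //; split => //=; rewrite v0.
have dir1 r : dirs r `<=` unit_sphere.
  move=> u [v [Xv /= /andP[v0 _]] <-]; apply: eucl_norm_normalize.
  by rewrite subr_eq0 -eucl_dist_gt0.
have [|s [s1 sF]] := compact_unit_sphere (F := F).
  by exists 1; [exact: ltr01|exact: dir1].
exists s => // t t0.
have [r r0 Xr] : exists2 r, 0 < r & forall v w, X v -> X w -> 0 < eucl_dist v x <= r ->
    0 < eucl_dist w x <= r -> ~ wide x (w - x) (t / 2) v.
  apply: contrapT => H; apply: nspread; exists (t / 2); first by rewrite divr_gt0.
  move=> r r0; apply: contrapT => H2; apply: H; exists r => // v w Xv Xw vr wr vw.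
  by apply: H2; exists v, w.
exists r => // y [[Xy yr] yt]; apply/eqP/negPn/negP => yx.
have y0 : y - x != 0 by rewrite subr_eq0.
(* Passing from the sup norm to the Euclidean norm costs the factor [n], and [gram_lip] a factor 2:
   in total [t / 4], so at least [t / 2] remains of [t]. *)
set e := t / (8 * n%:R).
have n0R : 0 < n%:R :> R by rewrite ltr0n.
have e0 : 0 < e by rewrite divr_gt0// mulr_gt0.
have [_ [[v [Xv /= /andP[v0 vr]] <-] sv]] :
    (dirs r `&` ball s e) !=set0.
  by apply: sF; [exists r|exact: nbhsx_ballx].
have v0' : v - x != 0 by rewrite subr_eq0 -eucl_dist_gt0.
have ds : eucl_dist s (normalize (v - x)) <= t / 8.
  apply: le_trans (eucl_norm_le _) _; move: sv; rewrite -ball_normE/= => /ltW sv.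
  apply: (@le_trans _ _ (n%:R * e)); first by rewrite ler_wpM2l.
  by rewrite /e le_eqVlt; apply/orP; left; apply/eqP; field; rewrite gt_eqF.
have yr' : 0 < eucl_dist y x <= r by rewrite eucl_dist_gt0 yx.
apply: (Xr y v Xy Xv yr'); first by rewrite v0.
rewrite /wide/= (gram_normalize y0 v0') mulrC ler_wpM2l ?sqr_ge0//.
have := gram_lip (eucl_norm_normalize y0) s1 (eucl_norm_normalize v0').
have : t <= gram (normalize (y - x)) s.
  move: yt; rewrite /wide/= (gramC _ s) (gram_normalizer s y0) s1 mulr1 mulrC.
  by rewrite ler_pM2l ?exprn_gt0 ?eucl_norm_gt0// gramC.
by move: ds; lra.
Qed.

Lemma spread_limit_pt X x t : spread X x t -> limit_pt X x.
Proof. by move=> Xt r /Xt[v [w [Xv _ vr _ _]]]; exists v. Qed.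

(** By [gram_triangle], a direction cannot be close to both members of a separated pair: one of the
    two determinants is at least [t / 4]. *)
Lemma spread_wide X x t y : spread X x t -> y != x ->
  exists v, [/\ X v, v != x, eucl_dist v x <= eucl_dist y x &
    wide x (v - x) (t / 4) y].
Proof.
move=> Xt yx; have y0 : 0 < eucl_dist y x by rewrite eucl_dist_gt0.
have [v [w [Xv Xw /andP[v0 vy] /andP[w0 wy] vw]]] := Xt _ y0.
rewrite eucl_dist_gt0 in v0; rewrite eucl_dist_gt0 in w0.
have := yx; rewrite -subr_eq0 => {}y0.
have := v0; rewrite -subr_eq0 => v0'; have := w0; rewrite -subr_eq0 => w0'.
have := gram_triangle (eucl_norm_normalize y0) (eucl_norm_normalize v0')
  (eucl_norm_normalize w0').
have : t <= gram (normalize (v - x)) (normalize (w - x)).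
  move: vw; rewrite /wide/= (gram_normalize v0' w0') mulrC.
  by rewrite ler_pM2l// exprn_gt0// mulr_gt0 ?eucl_norm_gt0.
move=> g1 g2.
have := leP (t / 4) (gram (normalize (y - x)) (normalize (v - x))).
case=> g3; [exists v | exists w]; split => //; rewrite /wide/= gram_normalize//
  mulrC ler_wpM2l ?sqr_ge0//; lra.
Qed.

Lemma spread_inv_circumradius_ge X x t y : 0 < t -> spread X x t -> X y -> y != x ->
  exists v w, [/\ X v, X w, distinct3 y v w &
    ((Num.sqrt (t / 4) / 8 / eucl_dist y x)%:E <= (circumradius y v w)^-1)%E].
Proof.
move=> t0 Xt Xy yx; have [v [Xv vx vy yv]] := spread_wide Xt yx.
have [|||w [Xw D yvw]] := limit_pt_inv_circumradius_ge
  (spread_limit_pt Xt) _ _ yx vx _ vy yv => //.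
- by rewrite divr_gt0.
- by rewrite eucl_dist_gt0.
by exists v, w.
Qed.

End geometry.

(** * Hausdorff measure *)

Section hausdorff_facts.
Context {R : realType} {n : nat}.
Implicit Types (A B : set 'rV[R]_n) (a d delta : R).

Lemma hausdorff_set1 a (x : 'rV[R]_n) : (0 < a)%R -> hausdorff eucl_dist a [set x] = 0.
Proof.
move=> a0; apply/eqP; rewrite eq_le hausdorff_ge0 andbT.
have dx : diam eucl_dist [set x] = 0.
  apply/eqP; rewrite eq_le; apply/andP; split.
    by apply: ge_ereal_sup => _ [_ -> [_ -> <-]]; rewrite eucl_distxx.
  by apply: ereal_sup_ubound; exists x => //; exists x => //; rewrite eucl_distxx.
apply: ge_ereal_sup => _ [delta d0 <-]; apply: ereal_inf_lbound.
exists (fun k => if k == 0%N then [set x] else set0).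
  split=> [_ ->|[|k]/=]; first by exists 0%N.
    by rewrite dx lee_fin ltW.
  by rewrite diam0 leNye.
apply: eseries0 => -[|k] _ _ /=; last exact: diam_pow0.
rewrite /diam_pow dx; case: ifPn => // _.
by rewrite poweR0r// gt_eqF.
Qed.

Lemma hausdorffU2 a A B : hausdorff eucl_dist a (A `|` B) <=
  hausdorff eucl_dist a A + hausdorff eucl_dist a B.
Proof. exact: (outer_measureU2 (hausdorff eucl_dist a)). Qed.

Lemma hausdorff_delta_nincr a A delta delta' : (delta' <= delta)%R ->
  hausdorff_delta eucl_dist a delta A <= hausdorff_delta eucl_dist a delta' A.
Proof.
move=> dd; apply: ereal_inf_le_tmp => _ [F [AF dF] <-]; exists F => //; split => // k.
by apply: le_trans (dF k) _; rewrite lee_fin.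
Qed.

(** A covering set of diameter less than [d] cannot meet both [A] and [B], so a fine covering sum
    splits into one for each. *)
Lemma hausdorff_separated a d A B : (0 <= a)%R -> (0 < d)%R ->
  (forall u v, A u -> B v -> d <= eucl_dist u v)%R ->
  hausdorff eucl_dist a A + hausdorff eucl_dist a B <= hausdorff eucl_dist a (A `|` B).
Proof.
move=> a0 d0 AB; set M := hausdorff _ _ (_ `|` _).
(* Independent meshes for [A] and [B] let the two suprema be taken one after the other. *)
have HM delta1 delta2 : (0 < delta1)%R -> (0 < delta2)%R ->
    hausdorff_delta eucl_dist a delta1 A + hausdorff_delta eucl_dist a delta2 B <= M.
  move=> d1 d2; pose delta := Num.min (Num.min delta1 delta2) (d / 2)%R.
  have [dd1 dd2 ddd] :
      [/\ (delta <= delta1)%R, (delta <= delta2)%R & (delta <= d / 2)%R].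
    by rewrite /delta !ge_min !lexx ?orbT; split.
  have delta0 : (0 < delta)%R by rewrite !lt_min d1 d2 divr_gt0.
  apply: (le_trans (leeD (hausdorff_delta_nincr a A dd1)
                         (hausdorff_delta_nincr a B dd2))).
  apply: le_trans (hausdorff_delta_le eucl_dist a _ delta0).
  apply: le_ereal_inf_tmp => _ [F [AF dF] <-].
  have bnd C : C `<=` A `|` B -> hausdorff_delta eucl_dist a delta C <=
      \sum_(k <oo) diam_pow eucl_dist a (F k `&` C).
    move=> CAB; apply: ereal_inf_lbound; exists (fun k => F k `&` C) => //; split.
      by move=> u Cu; have [k _ Fk] := AF u (CAB _ Cu); exists k.
    by move=> k; apply: le_trans (dF k); exact: le_diam.
  apply: (le_trans (leeD (bnd A (@subsetUl _ _ _)) (bnd B (@subsetUr _ _ _)))).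
  rewrite -nneseriesD; [|by move=> *; exact: diam_pow_ge0..].
  apply: lee_nneseries => [k _ _|k _]; first by rewrite adde_ge0// diam_pow_ge0.
  have [->|/set0P[u [Fu Au]]] := eqVneq (F k `&` A) set0.
    by rewrite diam_pow0 add0e le_diam_pow.
  rewrite [F k `&` B](_ : _ = set0) ?diam_pow0 ?adde0 ?le_diam_pow//.
  rewrite -subset0 => v [Fv Bv]; have := AB u v Au Bv; apply/negP; rewrite -ltNge.
  apply: (@le_lt_trans _ _ delta); last first.
    by apply: le_lt_trans ddd _; rewrite ltr_pdivrMr// ltr_pMr// ltr1n.
  rewrite -lee_fin; apply: le_trans (dF k).
  by apply: ereal_sup_ubound; exists u => //; exists v.
have [->|Moo] := eqVneq M +oo; first by rewrite leey.
have M0 : 0 <= M by exact: hausdorff_ge0.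
have Mfin : M \is a fin_num by rewrite ge0_fin_numE// lt_neqAle Moo leey.
have hfin C x : 0 <= C -> 0 <= x -> x + C <= M -> C \is a fin_num.
  move=> C0 x0 xC; rewrite ge0_fin_numE// (@le_lt_trans _ _ M)//.
    by apply: le_trans xC; rewrite leeDr.
  by rewrite lt_neqAle Moo leey.
have HA delta2 : (0 < delta2)%R ->
    hausdorff eucl_dist a A + hausdorff_delta eucl_dist a delta2 B <= M.
  move=> d2; have h2 := hausdorff_delta_ge0 eucl_dist a delta2 B.
  have f2 := hfin _ _ h2 (hausdorff_delta_ge0 eucl_dist a 1 A) (HM 1%R delta2 ltr01 d2).
  by rewrite -leeBrDr//; apply: ge_ereal_sup => _ [delta1 d1 <-]; rewrite leeBrDr// HM.
have fA : hausdorff eucl_dist a A \is a fin_num.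
  apply: (hfin _ (hausdorff_delta eucl_dist a 1 B)).
  - exact: hausdorff_ge0.
  - exact: hausdorff_delta_ge0.
  - by rewrite addeC HA.
rewrite addeC -leeBrDr//; apply: ge_ereal_sup => _ [delta2 d2 <-].
by rewrite leeBrDr// addeC HA.
Qed.

(* Caratheodory's criterion. With [T k] the part of [A] where [phi >= 1 / (k + 1)]
   and [D k] the layer [1 / (k + 3) <= phi < 1 / (k + 2)], separation gives
   [H (T k) + H (D k) <= H (T (k + 2))], hence the measures of the layers are
   summable by telescoping. *)
Lemma caratheodory_lipschitz a (phi : 'rV[R]_n -> R) (L : R) :
  (0 <= a)%R -> (0 < L)%R ->
  (forall u v, phi u - phi v <= L * eucl_dist u v)%R ->
  (hausdorff eucl_dist a).-caratheodory [set y | (phi y <= 0)%R].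
Proof.
move=> a0 L0 lip; apply: le_caratheodory_measurable => A.
pose S := [set y | (phi y <= 0)%R].
pose H : set 'rV[R]_n -> \bar R := hausdorff eucl_dist a.
rewrite -[leLHS]/(H (A `&` S) + H (A `&` ~` S)) -[leRHS]/(H A).
have [->|Aoo] := eqVneq (H A) +oo; first by rewrite leey.
have HS B C e : (0 < e)%R -> B `<=` A -> C `<=` A ->
    (forall u v, B u -> C v -> e <= phi u - phi v)%R -> H B + H C <= H (B `|` C).
  move=> e0 BA CA BC; apply: (@hausdorff_separated _ (e / L)) => //.
    by rewrite divr_gt0.
  by move=> u v Bu Cv; rewrite ler_pdivrMr// mulrC (le_trans (BC _ _ Bu Cv)).
pose T k := A `&` [set y | (k.+1%:R^-1 <= phi y)%R].
pose D k := A `&` [set y | (k.+3%:R^-1 <= phi y < k.+2%:R^-1)%R].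
have TA k : T k `<=` A by move=> ? [].
have DA k : D k `<=` A by move=> ? [].
have H0 B : 0 <= H B by exact: hausdorff_ge0.
have HAfin B : B `<=` A -> H B \is a fin_num.
  move=> BA; rewrite ge0_fin_numE// (@le_lt_trans _ _ (H A)) ?le_hausdorff//.
  by rewrite lt_neqAle Aoo leey.
have invS k m : (k <= m)%N -> (m.+1%:R^-1 <= k.+1%:R^-1 :> R)%R.
  by move=> km; rewrite lef_pV2 ?posrE ?ltr0n// ler_nat ltnS.
have TD k : H (T k) + H (D k) <= H (T k.+2).
  apply: (@le_trans _ _ (H (T k `|` D k))).
    apply: (@HS _ _ (k.+1%:R^-1 - k.+2%:R^-1)%R) => //.
      by rewrite subr_gt0 ltf_pV2 ?posrE ?ltr0n// ltr_nat.
    move=> u v [_ /= Tu] [_ /= /andP[_ Dv]]; exact: lerB Tu (ltW Dv).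
  apply: le_hausdorff => y [[Ay Ty]|[Ay /= /andP[Dy _]]]; split => //=.
  by apply: le_trans Ty; exact: invS (leq_trans (leqnSn _) (leqnSn _)).
(* [TD] telescopes in steps of two, hence two boundary terms. *)
have sumD N : \sum_(0 <= k < N) H (D k) <= H (T N) + H (T N.+1).
  elim: N => [|N IH]; first by rewrite big_nil adde_ge0.
  rewrite big_nat_recr//=; apply: le_trans (leeD IH (lexx _)) _.
  by rewrite addeAC addeC leeD2l.
have sumDoo : \sum_(k <oo) H (D k) < +oo.
  apply: (@le_lt_trans _ _ (H A + H A)).
    apply: lime_le; first by apply: is_cvg_nneseries.
    by apply: nearW => N; apply: le_trans (sumD N) _; apply: leeD; exact: le_hausdorff.
  by rewrite -ge0_fin_numE ?adde_ge0// fin_numD !HAfin.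
apply/lee_addgt0Pr => e e0.
have [N _ /(_ N (leqnn N))] :
    \forall N \near \oo, \sum_(N <= k <oo) H (D k) < e%:E.
  have e0E : 0 < e%:E by rewrite lte_fin.
  have tail := nneseries_tail_cvg sumDoo (fun k _ => H0 (D k)).
  apply: (tail [set z | z < e%:E]).
  by apply: open_nbhs_nbhs; split; [exact: open_ereal_lt_ereal|].
move=> /ltW tailN.
(* A point with [phi y > 0] lies in some [T] of large index. Descending to [N.+1], it either stays
   in each [T] or falls into a layer [D k] with [N <= k]. *)
have cover : A `&` ~` S `<=` T N.+1 `|` \bigcup_k (if (N <= k)%N then D k else set0).
  move=> y [Ay /negP]; rewrite -ltNge => y0.
  have Tj j : T (N.+1 + j)%N y ->
      (T N.+1 `|` \bigcup_k (if (N <= k)%N then D k else set0)) y.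
    elim: j => [|j IH]; first by rewrite addn0; left.
    move=> [_]; rewrite addnS addSn/= => yj.
    have [jy|yj'] := leP ((N + j).+2%:R^-1)%R (phi y); first exact: IH.
    by right; exists (N + j)%N => //; rewrite leq_addr; split => //=; rewrite yj.
  apply: (Tj (Num.truncn (phi y)^-1)); split => //=.
  rewrite -[leRHS]invrK lef_pV2 ?posrE ?invr_gt0 ?ltr0n//.
  by apply: le_trans (ltW (truncnS_gt _)) _; rewrite ler_nat ltnS leq_addl.
apply: (@le_trans _ _ (H (A `&` S) + (H (T N.+1) + e%:E))).
  rewrite leeD2l//; apply: le_trans (le_hausdorff _ _ cover) _.
  apply: le_trans (hausdorffU2 _ _ _) _; rewrite leeD2l//.
  apply: le_trans (hausdorff_sigma_subadditive _ _ _) _.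
  apply: le_trans tailN; rewrite [leRHS]eseries_cond [leRHS]eseries_mkcond/=.
  by apply: lee_nneseries => k _ //; case: ifP => // _; rewrite hausdorff0.
(* [phi] is at least [1 / (N + 2)] on [T N.+1] and at most 0 on [S], so the two sets are
   separated. *)
rewrite addeA leeD2r// addeC; apply: le_trans (_ : H (T N.+1 `|` (A `&` S)) <= _).
  apply: (@HS _ _ (N.+2%:R^-1)%R) => //.
  move=> u v [_ /= Tu] [_]; rewrite /S/= => Sv.
  by rewrite -[leLHS]subr0; exact: lerB Tu Sv.
by apply: le_hausdorff => y [[]|[]].
Qed.

End hausdorff_facts.

(** * Lower bounds of integrals *)

Section lower_integral.
Context {R : realType} {n : nat} (X : set 'rV[R]_n) (a : R).
Hypothesis a0 : (0 < a)%R.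
Implicit Types (A B S : set 'rV[R]_n) (c : R) (f g : 'rV[R]_n -> \bar R).

Local Notation H := (hausdorff eucl_dist a).
Local Notation cara := (caratheodory_type (hausdorff_on X a)).

(* [hausdorff_on X a] itself is not recognized as an [OuterMeasure.sort], which blocks
   the inference of its measure structure. *)
Let outer : {outer_measure set 'rV[R]_n -> \bar R} := hausdorff_on X a.

Definition hausdorff_measure : {measure set cara -> \bar R} :=
  (outer : set (caratheodory_type outer) -> \bar R).

Lemma integral_onE f : integral_on X a f = \int[hausdorff_measure]_(x in X) f x.
Proof. by []. Qed.

Lemma hausdorff_measureE A : hausdorff_measure A = H (A `&` X).
Proof. exact: hausdorff_onE (ltW a0). Qed.

(** [hausdorff_on X a] does not charge the complement of [X], so [X] splits every set additively,
    whatever its measurability in the ambient space. *)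
Lemma measurable_X : measurable (X : set cara).
Proof.
apply: le_caratheodory_measurable => A /=.
rewrite [leLHS](_ : _ = H (A `&` X `&` X) + H (A `&` ~` X `&` X)); last first.
  by congr (_ + _); exact: hausdorff_onE (ltW a0).
rewrite -!setIA setICl setI0 hausdorff0 adde0 setIid.
by rewrite -(hausdorff_onE _ _ (ltW a0)).
Qed.

Lemma measurable_lipschitz (phi : 'rV[R]_n -> R) (L : R) : (0 < L)%R ->
  (forall u v, phi u - phi v <= L * eucl_dist u v)%R ->
  measurable ([set y | (phi y <= 0)%R] : set cara).
Proof.
move=> L0 lip.
suff : (hausdorff_on X a).-caratheodory [set y | (phi y <= 0)%R] by [].
move=> A; rewrite 3?[hausdorff_on X a _](hausdorff_onE _ _ (ltW a0)).
rewrite (caratheodory_lipschitz (ltW a0) L0 lip (A `&` X)).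
by rewrite setIAC; congr (_ + hausdorff eucl_dist a _); rewrite setIAC.
Qed.

Lemma measurable_eucl_ball x r : measurable (eucl_ball x r : set cara).
Proof.
rewrite (_ : eucl_ball x r = [set y | (eucl_dist y x - r <= 0)%R]); last first.
  by apply/seteqP; split => y; rewrite /eucl_ball/= subr_le0.
apply: (@measurable_lipschitz _ 1%R) => // u v; rewrite mul1r opprB addrA subrK.
by rewrite lerBlDr eucl_dist_triangle.
Qed.

Lemma measurable_set1 (x : 'rV[R]_n) : measurable ([set x] : set cara).
Proof.
rewrite (_ : [set x] = eucl_ball x 0); first exact: measurable_eucl_ball.
apply/seteqP; split => [y ->|y]; rewrite /eucl_ball/= ?eucl_distxx//.
by rewrite leNgt eucl_dist_gt0 negbK => /eqP.
Qed.

(** As [t <= 1], the condition reads [|dotp (y - x) s| <= sqrt (1 - t) |s| |y - x|], a sublevel set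
    of a Lipschitz function. *)
Lemma measurable_wide x s t : (t <= 1)%R -> measurable (wide x s t : set cara).
Proof.
move=> t1; pose k := (Num.sqrt (1 - t) * eucl_norm s)%R.
have k0 : (0 <= k)%R by rewrite mulr_ge0 ?sqrtr_ge0 ?eucl_norm_ge0.
pose phi (y : 'rV[R]_n) : R := (`|dotp (y - x) s| - k * eucl_norm (y - x))%R.
rewrite (_ : wide x s t = [set y | (phi y <= 0)%R]); last first.
  apply/funext => y; apply/propext; rewrite /wide/phi/k/= subr_le0 -ler_sqr ?nnegrE//;
    last by rewrite mulr_ge0 ?eucl_norm_ge0.
  rewrite real_normK ?num_real// !exprMn !sqr_eucl_norm sqr_sqrtr ?subr_ge0// /gram.
  by split; lra.
apply: (@measurable_lipschitz _ (eucl_norm s + k + 1)%R).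
  by rewrite ltr_wpDl// addr_ge0 ?eucl_norm_ge0.
move=> u v; rewrite /phi.
have uv : (u - x - (v - x) = u - v)%R by rewrite opprB addrA subrK.
have := eucl_norm_lip (u - x) (v - x); rewrite /eucl_dist uv.
rewrite ler_norml => /andP[d1 _].
have : (`|dotp (u - x) s| - `|dotp (v - x) s| <= eucl_norm s * eucl_norm (u - v))%R.
  apply: le_trans (lerB_dist _ _) _; rewrite -dotpBl uv mulrC; exact: norm_dotp_le.
have : (k * (eucl_norm (v - x) - eucl_norm (u - x)) <= k * eucl_norm (u - v))%R.
  by rewrite ler_wpM2l//; lra.
by have := eucl_norm_ge0 (u - v); lra.
Qed.

Lemma le_integral_on f g : (forall y, X y -> 0 <= f y) ->
  (forall y, X y -> f y <= g y) -> integral_on X a f <= integral_on X a g.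
Proof.
move=> f0 fg; have g0 y : X y -> 0 <= g y.
  by move=> Xy; exact: le_trans (f0 y Xy) (fg y Xy).
rewrite !integral_onE !ge0_integralE//.
apply: ereal_sup_le => _ [h hf <-]; exists h => // y.
apply: le_trans (hf y) _; rewrite /patch; case: ifPn => // yX; exact: fg (set_mem yX).
Qed.

(** Chebyshev's inequality, through the measurable minorant [c * \1_S]. *)
Lemma integral_on_ge c S f : measurable (S : set cara) -> (0 <= c)%R ->
  (forall y, X y -> 0 <= f y) -> (forall y, X y -> S y -> c%:E <= f y) ->
  c%:E * H (X `&` S) <= integral_on X a f.
Proof.
move=> mS c0 f0 fS.
apply: le_trans (_ : integral_on X a (fun y => (c * \1_S y)%:E) <= _); last first.
  apply: le_integral_on => y Xy; first by rewrite lee_fin mulr_ge0.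
  rewrite indicE; have [/set_mem Sy|_] := boolP (y \in S).
    by rewrite mulr1; exact: fS.
  by rewrite mulr0; exact: f0.
rewrite integral_onE.
rewrite (@integralZl_indic _ _ _ hausdorff_measure _ measurable_X (fun=> S))//;
  last by rewrite ltNge c0.
rewrite (integral_indic hausdorff_measure measurable_X)// hausdorff_measureE.
by rewrite -setIA setIid setIC.
Qed.

Lemma hausdorffD1 A (x : 'rV[R]_n) : H A <= H (A `\ x).
Proof.
apply: (@le_trans _ _ (H ((A `\ x) `|` [set x]))).
  by apply: le_hausdorff => y Ay; have [->|yx] := eqVneq y x;
    [right|left; split => //; exact/eqP].
by apply: le_trans (hausdorffU2 _ _ _) _; rewrite hausdorff_set1// adde0.
Qed.

(* Along a sequence of radii that decreases fast enough, half of the mass of each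
   ball lies in the annulus up to the next ball, and each annulus contributes at
   least [c ^+ 2 / 2] to the integral. *)
Lemma integral_on_pinfty f x c b : (0 < c)%R -> (a <= b)%R ->
  (forall y, X y -> 0 <= f y) ->
  (forall rho, (0 < rho)%R -> exists2 r, (0 < r < rho)%R &
    (c * r `^ a)%:E <= H (X `&` eucl_ball x r) /\
    forall y, X y -> y != x -> eucl_ball x r y -> (c * r `^ (- b))%:E <= f y) ->
  integral_on X a f = +oo.
Proof.
move=> c0 ab f0 fr; apply/eqP/negPn/negP => Ioo.
have b0 : (0 < b)%R by exact: lt_le_trans ab.
set I := integral_on X a f in Ioo.
have [i i0 Ii] : exists2 i : R, (0 <= i)%R & I = i%:E.
  have I0 : 0 <= I by rewrite /I integral_onE integral_ge0.
  have : I \is a fin_num by rewrite ge0_fin_numE// lt_neqAle Ioo leey.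
  by move=> /fineK IE; exists (fine I) => //; exact: fine_ge0.
pose good r := (c * r `^ a)%:E <= H (X `&` eucl_ball x r) /\
    forall y, X y -> y != x -> eucl_ball x r y -> (c * r `^ (- b))%:E <= f y.
(* With a finite integral, Chebyshev makes the mass of good balls at most of order [r^b]. The bound
   on [f] excludes [x], which is removed as a null set. *)
have mass r : (0 < r)%R -> good r -> H (X `&` eucl_ball x r) <= (i * r `^ b / c)%:E.
  move=> r0 [_ rf].
  have cr0 : (0 < c * r `^ (- b))%R by rewrite mulr_gt0 ?powR_gt0.
  have mB : measurable (eucl_ball x r `\ x : set cara).
    by apply: measurableD; [exact: measurable_eucl_ball|exact: measurable_set1].
  have := integral_on_ge mB (ltW cr0) f0.
  have fB y : X y -> (eucl_ball x r `\ x) y -> (c * r `^ (- b))%:E <= f y.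
    by move=> Xy [yB /eqP yx]; exact: rf.
  move=> /(_ fB); rewrite -/I Ii setIDA.
  rewrite -lee_pdivlMl// -EFinM powRN => hI.
  apply: le_trans (hausdorffD1 _ x) (le_trans hI _).
  by rewrite lee_fin invfM invrK mulrC mulrA (mulrAC i).
pose c1 := (c ^+ 2 / 2)%R; have c10 : (0 < c1)%R by rewrite divr_gt0// exprn_gt0.
(* Measurable minorants of [f] with integral at least [K * c1]. Their support in an arbitrarily
   small ball leaves room for one more annulus outside. *)
have step K : forall rho, (0 < rho)%R -> exists g : 'rV[R]_n -> R,
    [/\ measurable_fun setT (g : cara -> R), (forall y, 0 <= g y)%R,
        (forall y, rho < eucl_dist y x -> g y = 0)%R,
        (forall y, X y -> (g y)%:E <= f y) &
        (K%:R * c1)%:E <= integral_on X a (EFin \o g)].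
  elim: K => [|K IH] rho rho0.
    exists (fun=> 0%R); split => //.
    by rewrite mul0r integral_onE integral_ge0.
  (* Keeping [r < 1] ensures [1 <= r^(a - b)] at the end of the step. *)
  have rho1 : (0 < Num.min rho 1)%R by rewrite lt_min rho0 ltr01.
  have [r /andP[r0]] := fr _ rho1; rewrite lt_min => /andP[rrho r1] [rm rf].
  (* Chosen so that [r'^b <= q] and [mass] leave at most half of the lower bound [c * r^a] in the
     inner ball; [i + 1] avoids division by zero. *)
  pose q := (c ^+ 2 * r `^ a / (2 * (i + 1)))%R.
  have i10 : (0 < i + 1)%R by rewrite ltr_wpDl.
  have q0 : (0 < q)%R by rewrite divr_gt0// mulr_gt0 ?exprn_gt0 ?powR_gt0.
  have : (0 < Num.min r (q `^ b^-1))%R by rewrite lt_min r0 powR_gt0.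
  move=> /fr[r' /andP[r'0]]; rewrite lt_min => /andP[r'r r'q] gr'.
  have {}r'q : (r' `^ b <= q)%R.
    have : (r' `^ b <= (q `^ b^-1) `^ b)%R.
      by apply: ge0_ler_powR; rewrite ?nnegrE ?powR_ge0// ltW.
    by rewrite -powRrM mulVf ?gt_eqF// powRr1// ltW.
  have r'm : H (X `&` eucl_ball x r') <= (c / 2 * r `^ a)%:E.
    apply: le_trans (mass _ r'0 gr') _; rewrite lee_fin ler_pdivrMr//.
    apply: (@le_trans _ _ ((i + 1) * q)%R).
      by rewrite ler_pM ?powR_ge0// lerDl.
    rewrite /q le_eqVlt; apply/orP; left; apply/eqP; field; rewrite gt_eqF//.
  have [g [mg g0 gout gf gI]] := IH _ r'0.
  pose Q := eucl_ball x r `\` eucl_ball x r'.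
  have mQ : measurable (Q : set cara).
    by apply: measurableD; exact: measurable_eucl_ball.
  have Qm : (c / 2 * r `^ a)%:E <= H (X `&` Q).
    have : H (X `&` eucl_ball x r) <= H (X `&` Q) + H (X `&` eucl_ball x r').
      apply: le_trans (hausdorffU2 _ _ _); apply: le_hausdorff => y [Xy yr].
      by have [yr'|yr'] := pselect (eucl_ball x r' y); [right|left].
    move=> /(le_trans rm) /le_trans /(_ (leeD (lexx _) r'm)).
    case: (H _) => [h||] //=.
      by rewrite -EFinD !lee_fin; lra.
    by move=> _; rewrite leey.
  pose k := (c * r `^ (- b))%R; have k0 : (0 <= k)%R by rewrite mulr_ge0 ?powR_ge0 ?ltW.
  have mk : measurable_fun setT ((fun y => k * \1_Q y)%R : cara -> R).
    by apply: measurable_funM => //; exact: measurable_indic.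
  exists (fun y => g y + k * \1_Q y)%R; split.
  - exact: measurable_funD.
  - by move=> y; rewrite addr_ge0// mulr_ge0.
  - move=> y yrho; rewrite gout; last by apply: lt_trans yrho; exact: lt_trans rrho.
    rewrite indicE memNset ?mulr0 ?addr0// => -[yr _].
    by move: yr; rewrite /eucl_ball/= leNgt (lt_trans rrho).
  - move=> y Xy; rewrite indicE; have [/set_mem[yr yr']|yQ] := boolP (y \in Q).
      rewrite gout; last by rewrite ltNge; apply/negP.
      rewrite add0r mulr1; apply: rf => //; apply: contra_notN yr' => /eqP ->.
      by rewrite /eucl_ball/= eucl_distxx ltW.
    by rewrite mulr0 addr0 gf.
  - rewrite integral_onE (_ : _ \o _ = fun y => (g y)%:E + (k * \1_Q y)%:E); last first.
      by apply/funext => y; rewrite /= EFinD.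
    rewrite (@ge0_integralD _ _ _ hausdorff_measure _ measurable_X); first last.
    - apply: measurable_funTS; exact/measurable_EFinP.
    - by move=> y _; rewrite lee_fin mulr_ge0.
    - apply: measurable_funTS; exact/measurable_EFinP.
    - by move=> y _; rewrite lee_fin.
    rewrite -natr1 mulrDl mul1r EFinD leeD//.
    apply: (@le_trans _ _ (k%:E * H (X `&` Q))); last first.
      rewrite -integral_onE; apply: integral_on_ge => // y Xy.
        by rewrite lee_fin mulr_ge0.
      by move=> Qy; rewrite indicE mem_set// mulr1.
    apply: (@le_trans _ _ (k%:E * (c / 2 * r `^ a)%:E)); last by rewrite lee_wpmul2l.
    rewrite -EFinM lee_fin /k /c1.
    have -> : (c * r `^ (- b) * (c / 2 * r `^ a) =
        c ^+ 2 / 2 * (r `^ a * r `^ (- b)))%R.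
      by field.
    rewrite ler_peMr ?(ltW c10)// -powRD ?(gt_eqF r0) ?implybT//.
    by rewrite -[leLHS](powRr0 r) ger_powR ?r0 ?(ltW r1)// subr_le0.
have [g [_ g0 _ gf]] := step (Num.truncn (i / c1)).+1 1%R ltr01.
move=> gI; have : (((Num.truncn (i / c1)).+1%:R * c1)%:E <= i%:E).
  rewrite -Ii; apply: le_trans gI _; apply: le_integral_on => // y _.
  by rewrite lee_fin.
by rewrite lee_fin -ler_pdivlMr// leNgt truncnS_gt.
Qed.

End lower_integral.

(** * Densities and approximate tangents *)

Section densities_facts.
Context {R : realType} {n : nat} (X : set 'rV[R]_n) (x : 'rV[R]_n) (a : R).
Hypothesis a0 : (0 < a)%R.
Implicit Types (A : set 'rV[R]_n) (r t e : R) (s : 'rV[R]_n).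

Local Notation H := (hausdorff eucl_dist a).

Lemma near_right0P (P : R -> Prop) : (\forall r \near 0^'+, P r) <->
  exists2 rho, (0 < rho)%R & forall r, (0 < r < rho)%R -> P r.
Proof.
split=> [[rho /= rho0 rhoP]|[rho rho0 rhoP]].
  exists rho => // r /andP[r0 rrho]; apply: rhoP => //=.
  by rewrite sub0r normrN gtr0_norm.
exists rho => //= r /=; rewrite sub0r normrN => rrho r0.
by apply: rhoP; rewrite r0 (le_lt_trans (ler_norm _)).
Qed.

Lemma density_ratio_le A r e : (0 < r)%R ->
  (density_ratio a x A r <= e%:E) =
  (H (A `&` eucl_ball x r) <= (e * (2 * r) `^ a)%:E).
Proof.
move=> r0; have r2 : (0 < (2 * r) `^ a)%R by rewrite powR_gt0// mulr_gt0.
by rewrite /density_ratio inver gt_eqF// lee_pdivrMr// EFinM.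
Qed.

Lemma density_ratio_ge A r e : (0 < r)%R ->
  (e%:E <= density_ratio a x A r) =
  ((e * (2 * r) `^ a)%:E <= H (A `&` eucl_ball x r)).
Proof.
move=> r0; have r2 : (0 < (2 * r) `^ a)%R by rewrite powR_gt0// mulr_gt0.
by rewrite /density_ratio inver gt_eqF// lee_pdivlMr// EFinM.
Qed.

Lemma density_ratio_ge0 A r : (0 < r)%R -> 0 <= density_ratio a x A r.
Proof. by move=> r0; rewrite density_ratio_ge// mul0r hausdorff_ge0. Qed.

Lemma density_ratio_cvg0 (A : R -> set 'rV[R]_n) :
  (forall e, (0 < e)%R -> exists2 rho, (0 < rho)%R & forall r, (0 < r < rho)%R ->
    H (A r `&` eucl_ball x r) <= (e * (2 * r) `^ a)%:E) ->
  density_ratio a x (A r) r @[r --> (0%R : R)^'+] --> 0.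
Proof.
move=> HA U /= [e /= e0 eU].
have [rho rho0 rhoP] := HA (e / 2)%R (divr_gt0 e0 (ltr0n _ 2)).
apply/near_right0P; exists rho => // r rrho; have /andP[r0 _] := rrho.
have := rhoP r rrho; rewrite -density_ratio_le// => he.
have h0 := density_ratio_ge0 (A r) r0.
have /fineK hE : density_ratio a x (A r) r \is a fin_num.
  by rewrite ge0_fin_numE// (le_lt_trans he) ?ltey.
move: he h0; rewrite -hE !lee_fin => he h0.
rewrite /preimage/= -hE; apply: eU; rewrite /= sub0r normrN ger0_norm//.
by apply: le_lt_trans he _; rewrite ltr_pdivrMr// ltr_pMr// ltr1n.
Qed.

Lemma tangent_line_approx_tangent s : unit_sphere s -> tangent_line X x s ->
  approx_tangent a X x.
Proof.
move=> s1 Xs; exists s; split => // e e0.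
have [t /andP[t0 t1] et] := @setC_double_cone_wide R n e e0.
have [rho rho0 rhoP] := Xs t t0.
apply: density_ratio_cvg0 => d d0; exists rho => // r /andP[r0 rrho].
apply: (@le_trans _ _ (H [set x])); last first.
  by rewrite hausdorff_set1// lee_fin mulr_ge0 ?powR_ge0 ?ltW.
apply: le_hausdorff => y [[Xy yC] yr]; apply: rhoP; split; last exact: et.
by split => //; apply: le_trans yr (ltW rrho).
Qed.

Lemma approx_tangent_weak : approx_tangent a X x -> weak_approx_tangent a X x.
Proof. by move=> [s [s1 sX]]; exists 1%R, (fun=> s); split. Qed.

(** If the density of [X] at [x] were zero, every direction would be an approximate tangent. *)
Lemma not_density0 : (0 < n)%N -> ~ approx_tangent a X x ->
  exists2 e, (0 < e)%R & forall rho, (0 < rho)%R -> exists2 r, (0 < r < rho)%R &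
    (e * (2 * r) `^ a)%:E <= H (X `&` eucl_ball x r).
Proof.
move=> n0; apply: contra_notP => nX; have [s s1] := @exists_unit_sphere R n n0.
exists s; split => // e e0; apply: density_ratio_cvg0 => d d0.
apply: contrapT => nd; apply: nX; exists d => // rho rho0.
apply: contrapT => nr; apply: nd; exists rho => // r rrho.
rewrite leNgt; apply/negP => /ltW dH; apply: nr; exists r => //.
by apply: le_trans dH (le_hausdorff _ _ _) => y [[Xy _] yr].
Qed.

(* The direction at scale [r] is chosen for the smallest admissible opening, up to
   an error [r]. *)
Lemma weak_approx_tangentP :
  (forall t, (0 < t <= 1)%R -> exists2 rho, (0 < rho)%R &
    forall r, (0 < r < rho)%R -> exists2 s, unit_sphere s &
      H (X `&` wide x s t `&` eucl_ball x r) <= (t * (2 * r) `^ a)%:E) ->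
  weak_approx_tangent a X x.
Proof.
move=> HX.
pose ok r t s := [/\ (0 < t <= 1)%R, unit_sphere s &
  H (X `&` wide x s t `&` eucl_ball x r) <= (t * (2 * r) `^ a)%:E].
pose T r := [set t | exists s, ok r t s].
have Tlb r : has_lbound (T r) by exists 0%R => t [s [/andP[/ltW]]].
have [rho rho0 rhoP] := HX 1%R (ltac:(by rewrite ltr01 lexx)).
pose P r s := (0 < r < rho)%R -> exists2 t, (t < inf (T r) + r)%R & ok r t s.
have [s sP] : {s : R -> 'rV[R]_n & forall r, P r (s r)}.
  apply: (@choice _ _ P) => r; have [rr|nrr] := boolP (0 < r < rho)%R; last first.
    by exists 0%R; rewrite /P (negbTE nrr).
  have [s s1 sr] := rhoP r rr; have /andP[r0 _] := rr.
  have Tinf : has_inf (T r).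
    by split => //; exists 1%R, s; split => //; rewrite ltr01 lexx.
  have [t [s' ts'] tr] := inf_adherent r0 Tinf.
  by exists s' => _; exists t.
exists rho, s; split => // [r /sP[t _ []]//|e e0].
have [t0 /andP[t00 t01] et] := @setC_double_cone_wide R n e e0.
apply: density_ratio_cvg0 => d d0.
(* [t0] controls the opening and [d] the mass. The infimum is at most [t1 / 2] and the selection
   error [r] is below [t1 / 2], so the selected [t] is at most [t1]. *)
pose t1 := Num.min t0 d.
have t10 : (0 < t1)%R by rewrite lt_min t00.
have t11 : (t1 <= 1)%R by rewrite ge_min t01.
have t12 : (0 < t1 / 2 <= 1)%R by rewrite divr_gt0//=; lra.
have [rho' rho'0 rhoP'] := HX _ t12.
exists (Num.min (Num.min rho rho') (t1 / 2))%R.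
  by rewrite !lt_min rho0 rho'0 divr_gt0.
move=> r /andP[r0]; rewrite !lt_min -andbA => /and3P[rrho rrho' rt].
have [s' s'1 s'r] := rhoP' r (ltac:(by rewrite r0)).
have Tt : (inf (T r) <= t1 / 2)%R by apply: ge_inf => //; exists s'.
have [t tr [/andP[tt0 _] s1 sH]] := sP r (ltac:(by rewrite r0)).
have tt1 : (t <= t1)%R by move: tr Tt rt; lra.
apply: (@le_trans _ _ (H (X `&` wide x (s r) t `&` eucl_ball x r))).
  apply: le_hausdorff => y [[Xy yC] yr]; split => //; split => //.
  apply: subset_wide (et _ _ s1 _ yC).
  by apply: le_trans tt1 _; rewrite ge_min lexx.
apply: le_trans sH _; rewrite lee_fin ler_wpM2r ?powR_ge0//.
by apply: le_trans tt1 _; rewrite ge_min lexx orbT.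
Qed.

(** Stated for all nonzero [s], since it is applied to axes [y - x] through points of [X]. *)
Lemma not_weak_approx_tangent : ~ weak_approx_tangent a X x ->
  exists2 t, (0 < t <= 1)%R & forall rho, (0 < rho)%R ->
  exists2 r, (0 < r < rho)%R & forall s, s != 0%R ->
    (t * (2 * r) `^ a)%:E <= H (X `&` wide x s t `&` eucl_ball x r).
Proof.
apply: contra_notP => nX; apply: weak_approx_tangentP => t tt.
apply: contrapT => nrho; apply: nX; exists t => // rho rho0.
apply: contrapT => nr; apply: nrho; exists rho => // r rrho.
apply: contrapT => ns; apply: nr; exists r => // s s0.
rewrite leNgt; apply/negP => /ltW sH; apply: ns; exists (normalize s).
  exact: eucl_norm_normalize.
by rewrite wide_normalize.
Qed.

Lemma lower_density_gt0 : 0 < lower_density a X x ->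
  exists2 c, (0 < c)%R & exists2 rho, (0 < rho)%R &
    forall r, (0 < r < rho)%R -> (c * (2 * r) `^ a)%:E <= H (X `&` eucl_ball x r).
Proof.
rewrite /lower_density limf_einfE => /ereal_sup_gt[_ [V /near_right0P V0 <-] infV].
have [rho rho0 rhoV] := V0.
have [c c0 cV] : exists2 c, (0 < c)%R & c%:E <= ereal_inf (density_ratio a x X @` V).
  case: (ereal_inf _) infV => [c c0| _|//]; first by exists c.
  by exists 1%R; rewrite ?leey.
exists c => //; exists rho => // r rrho; have /andP[r0 _] := rrho.
rewrite -density_ratio_ge//; apply: le_trans cV _; apply: ereal_inf_lbound.
by exists r => //; exact: rhoV.
Qed.

Lemma upper_density_lty : upper_density a X x < +oo ->
  exists2 c, (0 < c)%R & exists2 rho, (0 < rho)%R &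
    forall r, (0 < r < rho)%R -> H (X `&` eucl_ball x r) <= (c * (2 * r) `^ a)%:E.
Proof.
rewrite /upper_density limf_esupE => /ereal_inf_lt[_ [V /near_right0P V0 <-] supV].
have [rho rho0 rhoV] := V0.
have [c c0 cV] : exists2 c, (0 < c)%R & ereal_sup (density_ratio a x X @` V) <= c%:E.
  case: (ereal_sup _) supV => [c _|//| _]; last by exists 1%R; rewrite ?leNye.
  exists (`|c| + 1)%R; first by rewrite ltr_wpDl.
  by rewrite lee_fin (le_trans (ler_norm _))// lerDl.
exists c => //; exists rho => // r rrho; have /andP[r0 _] := rrho.
rewrite -density_ratio_le//; apply: le_trans cV; apply: ereal_sup_ubound.
by exists r => //; exact: rhoV.
Qed.

End densities_facts.

(** * Divergence of the energies *)

Section energies_facts.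
Context {R : realType} {n : nat} (X : set 'rV[R]_n) (x : 'rV[R]_n) (a : R).
Hypothesis a0 : (0 < a)%R.
Implicit Types (u v w y z : 'rV[R]_n) (r t c p b : R) (f : 'rV[R]_n -> \bar R).

Local Notation H := (hausdorff eucl_dist a).

Lemma circumradius_ge0 u v w : 0 <= circumradius u v w.
Proof.
rewrite /circumradius/=; case: ifPn => // _.
by rewrite lee_fin divr_ge0 ?sqrtr_ge0// !mulr_ge0 ?eucl_dist_ge0.
Qed.

(** Inversion reverses the order on nonnegative extended reals, so each member of [S] bounds the
    inverse of the infimum from below. *)
Lemma le_inv_ereal_inf (S : set (\bar R)) (k q : \bar R) : (forall d, S d -> 0 <= d) ->
  S q -> k <= q^-1 -> k <= (ereal_inf S)^-1.
Proof.
move=> S0 Sq /le_trans; apply; have q0 := S0 _ Sq.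
have i0 : 0 <= ereal_inf S by exact: le_ereal_inf_tmp.
by rewrite lee_pV2 ?inE//; exact: ereal_inf_lbound.
Qed.

Lemma kappa_G_ge y v w (k : \bar R) : X v -> X w -> distinct3 y v w ->
  k <= (circumradius y v w)^-1 -> k <= kappa_G X y.
Proof.
move=> Xv Xw D; apply: le_inv_ereal_inf; last by exists v, w.
by move=> _ [? [? [_ _ _ ->]]]; exact: circumradius_ge0.
Qed.

Lemma inv_thickness_ge y v w (k : \bar R) : X y -> X v -> X w -> distinct3 y v w ->
  k <= (circumradius y v w)^-1 -> k <= (thickness X)^-1.
Proof.
move=> Xy Xv Xw D; apply: le_inv_ereal_inf; last by exists y, v, w.
by move=> _ [? [? [? [_ _ _ _ ->]]]]; exact: circumradius_ge0.
Qed.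

Lemma kappa_i_ge y v w (k : \bar R) : X w -> distinct3 y v w ->
  k <= (circumradius y v w)^-1 -> k <= kappa_i X y v.
Proof.
move=> Xw /and3P[yv vw wy]; rewrite /kappa_i (negbTE yv); apply: le_inv_ereal_inf.
  by move=> _ [? _ <-]; exact: circumradius_ge0.
exists w => //; split => // -[|] wE; move: vw wy; rewrite wE eqxx//.
Qed.

Lemma kappaE y v w : X y -> X v -> X w -> distinct3 y v w ->
  kappa X y v w = (circumradius y v w)^-1.
Proof. by move=> Xy Xv Xw D; rewrite /kappa !mem_set//= D. Qed.

Lemma le_EFin_poweR c p (k : \bar R) : (0 <= c)%R -> (0 <= p)%R ->
  c%:E <= k -> (c `^ p)%:E <= k `^ p.
Proof.
move=> c0 p0 ck; rewrite -poweR_EFin; apply: gt0_ler_poweR => //.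
  by rewrite in_itv/= leey lee_fin c0.
by rewrite in_itv/= leey andbT (le_trans _ ck)// lee_fin.
Qed.

Lemma powR_div c r p : (0 <= c)%R -> (0 < r)%R ->
  ((c / r) `^ p = c `^ p * r `^ (- p))%R.
Proof.
move=> c0 r0; rewrite powRM ?invr_ge0 ?(ltW r0)//.
by rewrite -[r^-1%R]powR_inv1 ?(ltW r0)// -powRrM mulN1r.
Qed.

Lemma integral_on_ge0 f : (forall y, X y -> 0 <= f y) -> 0 <= integral_on X a f.
Proof. by move=> f0; rewrite integral_onE integral_ge0. Qed.

Lemma integral_on_pinfty_const f c1 c2 b : (0 < c1)%R -> (0 < c2)%R -> (a <= b)%R ->
  (forall y, X y -> 0 <= f y) ->
  (forall rho, (0 < rho)%R -> exists2 r, (0 < r < rho)%R &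
    (c1 * (2 * r) `^ a)%:E <= H (X `&` eucl_ball x r) /\
    forall y, X y -> y != x -> eucl_ball x r y -> (c2 * r `^ (- b))%:E <= f y) ->
  integral_on X a f = +oo.
Proof.
move=> c10 c20 ab f0 fr; pose c := Num.min (c1 * 2 `^ a)%R c2.
apply: (@integral_on_pinfty _ _ _ _ a0 f x c b) => //.
  by rewrite lt_min c20 mulr_gt0 ?powR_gt0.
move=> rho /fr[r rrho [rH rf]]; have /andP[r0 _] := rrho; exists r => //; split.
  apply: le_trans rH; rewrite lee_fin powRM ?(ltW r0)// mulrA ler_wpM2r ?powR_ge0//.
  by rewrite ge_min lexx.
move=> y Xy yx yr; apply: le_trans (rf y Xy yx yr).
by rewrite lee_fin ler_wpM2r ?powR_ge0// ge_min lexx orbT.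
Qed.

Lemma lee_addKr c1 c2 (h k : \bar R) :
  (c1 + c2)%:E <= h + k -> k <= c2%:E -> c1%:E <= h.
Proof.
move=> hk kc; have := le_trans hk (leeD (lexx h) kc).
by case: h {hk} => [h|_|//]; rewrite ?leey// -EFinD !lee_fin; lra.
Qed.

(** Points [y] of [X] tending to [x] lie on triples of curvature at least [c / |y - x|], which is
    unbounded. *)
Lemma spread_thickness t : (0 < t)%R -> spread X x t -> (thickness X)^-1 = +oo.
Proof.
move=> t0 Xt; apply/eqyP => M M0.
pose c := (Num.sqrt (t / 4) / 8)%R.
have c0 : (0 < c)%R by rewrite divr_gt0// sqrtr_gt0 divr_gt0.
have [y Xy /andP[y0 yM]] := spread_limit_pt Xt (divr_gt0 c0 M0).
have yx : y != x by rewrite -eucl_dist_gt0.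
have [v [w [Xv Xw D cyvw]]] := spread_inv_circumradius_ge t0 Xt Xy yx.
apply: le_trans (inv_thickness_ge Xy Xv Xw D cyvw); rewrite lee_fin ler_pdivlMr//.
by move: yM; rewrite ler_pdivlMr// mulrC.
Qed.

Lemma spread_energy_U t p : (0 < t)%R -> spread X x t -> (0 < n)%N -> (a <= p)%R ->
  ~ approx_tangent a X x -> energy_U X a p = +oo.
Proof.
move=> t0 Xt n0 ap /(not_density0 n0)[e e0 Xe].
have p0 : (0 <= p)%R by rewrite (le_trans _ ap) ?ltW.
pose c := (Num.sqrt (t / 4) / 8)%R.
have c0 : (0 < c)%R by rewrite divr_gt0// sqrtr_gt0 divr_gt0.
apply: (@integral_on_pinfty_const _ e (c `^ p)%R p) => //; first by rewrite powR_gt0.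
  by move=> y _; exact: poweR_ge0.
move=> rho /Xe[r rrho rH]; have /andP[r0 _] := rrho; exists r => //.
split=> // y Xy yx yr.
have [v [w [Xv Xw D cyvw]]] := spread_inv_circumradius_ge t0 Xt Xy yx.
rewrite -(powR_div _ (ltW c0) r0); apply: le_EFin_poweR => //.
  by rewrite divr_ge0 ?ltW.
apply: le_trans (kappa_G_ge Xv Xw D cyvw).
rewrite lee_fin -/c ler_wpM2l ?(ltW c0)// lef_pV2 ?posrE ?eucl_dist_gt0//.
Qed.

(** For fixed [y], the inner integral runs over the points outside the cone around [y - x]: mass of
    order [r^a] and integrand at least [(c / r)^p]. Hence the exponent [b = p - a]. *)
Lemma limit_pt_energy_I p : limit_pt X x -> (2 * a <= p)%R ->
  ~ weak_approx_tangent a X x -> energy_I X a p = +oo.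
Proof.
move=> accX ap /not_weak_approx_tangent[t /andP[t0 t1] Xt].
have p0 : (0 <= p)%R by move: ap a0; lra.
pose c := (Num.sqrt t / 8)%R.
have c0 : (0 < c)%R by rewrite divr_gt0// sqrtr_gt0.
apply: (@integral_on_pinfty_const _ t (c `^ p * (t * 2 `^ a))%R (p - a)%R) => //.
- by rewrite !mulr_gt0 ?powR_gt0.
- by move: ap; lra.
- by move=> y _; apply: integral_on_ge0 => ? _; exact: poweR_ge0.
move=> rho rho0; have [r rrho rH] := Xt rho rho0; have /andP[r0 _] := rrho.
(* Any axis will do to extract the mass of the whole ball from [rH]. *)
have [u _ u0] := accX 1%R ltr01.
have ux : (u - x)%R != 0%R by rewrite subr_eq0 -eucl_dist_gt0; have /andP[] := u0.
exists r => //; split.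
  by apply: le_trans (rH _ ux) _; apply: le_hausdorff => y [[]].
move=> y Xy yx yr; have yx' : (y - x)%R != 0%R by rewrite subr_eq0.
pose S := wide x (y - x)%R t `&` eucl_ball x r `\ x.
have mS : measurable (S : set (caratheodory_type (hausdorff_on X a))).
  apply: measurableD; last exact: measurable_set1.
  by apply: measurableI; [exact: measurable_wide|exact: measurable_eucl_ball].
apply: le_trans (integral_on_ge a0 (c := ((c / r) `^ p)%R) mS _ _ _); first last.
- move=> z Xz [[zt zr] /eqP zx].
  apply: le_EFin_poweR => //; first by rewrite divr_ge0 ?ltW.
  have [w [Xw D zyw]] := limit_pt_inv_circumradius_ge accX t0 r0 zx yx zr yr zt.
  exact: kappa_i_ge Xw D zyw.
- by move=> z _; exact: poweR_ge0.
- exact: powR_ge0.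
apply: (@le_trans _ _ (((c / r) `^ p)%:E * (t * (2 * r) `^ a)%:E)).
  rewrite -EFinM lee_fin (powR_div _ (ltW c0) r0) (powRM _ (ler0n _ 2) (ltW r0)).
  have -> : (r `^ (- (p - a)) = r `^ (- p) * r `^ a)%R.
    by rewrite -powRD ?(gt_eqF r0) ?implybT// opprB addrC.
  by rewrite le_eqVlt; apply/orP; left; apply/eqP; ring.
rewrite lee_wpmul2l ?lee_fin ?powR_ge0//; apply: le_trans (rH _ yx') _.
by apply: le_trans (hausdorffD1 a0 _ x) _; rewrite /S setIDA setIA.
Qed.

(** Here the third point cannot be chosen freely. The outer variable [z] ranges over a ball of
    radius [delta * r], where the lower density gives mass; the other two range over the annulus
    between [eta * r] and [r]. *)
Lemma density_energy_M p : (0 < n)%N -> (3 * a <= p)%R ->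
  0 < lower_density a X x -> upper_density a X x < +oo ->
  ~ weak_approx_tangent a X x -> energy_M X a p = +oo.
Proof.
move=> n0 ap /lower_density_gt0[cl cl0 [rl rl0 Xl]].
move=> /upper_density_lty[cu cu0 [ru ru0 Xu]].
move=> /not_weak_approx_tangent[t /andP[t0 t1] Xt].
have p0 : (0 <= p)%R by move: ap a0; lra.
pose c := (Num.sqrt t / 8)%R.
have c0 : (0 < c)%R by rewrite divr_gt0// sqrtr_gt0.
(* By the upper density bound, the ball of radius [eta * r] holds at most half of the mass
   [t * (2r)^a] outside a cone. *)
pose eta := Num.min (1 / 2)%R ((t / (2 * cu)) `^ a^-1)%R.
have tcu0 : (0 < t / (2 * cu))%R by rewrite divr_gt0// mulr_gt0.
have eta0 : (0 < eta)%R by rewrite lt_min divr_gt0//= powR_gt0.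
have eta12 : (eta <= 1 / 2)%R by rewrite ge_min lexx.
have etaa : (cu * eta `^ a <= t / 2)%R.
  rewrite mulrC -ler_pdivlMr// -mulrA -invfM.
  have : (eta `^ a <= ((t / (2 * cu)) `^ a^-1) `^ a)%R.
    apply: ge0_ler_powR; rewrite ?nnegrE ?(ltW a0) ?(ltW eta0) ?powR_ge0//.
    by rewrite ge_min lexx orbT.
  by rewrite -powRrM mulVf ?gt_eqF// powRr1// ltW.
(* [inv_circumradius_ge] asks for [8 * r * (delta * r) * (2r)^2 <= t * (eta * r)^4], and the left
   side equals half of the right. *)
pose delta := (t * eta ^+ 4 / 64)%R.
have delta0 : (0 < delta)%R by rewrite divr_gt0// mulr_gt0// exprn_gt0.
have eta4 : (eta ^+ 4 <= eta)%R.
  by rewrite -[leRHS]expr1 ler_wiXn2l//; [exact: ltW|move: eta12; lra].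
have delta_eta : (delta < eta)%R.
  have : (t * eta ^+ 4 <= eta)%R.
    by apply: le_trans eta4; rewrite ger_pMl// exprn_gt0.
  by rewrite /delta; move: eta0; lra.
have delta1 : (delta < 1)%R by move: delta_eta eta12; lra.
pose b := (p - 2 * a)%R.
(* The factor [delta^b] absorbs the change of scale from [r] to [delta * r]; the square comes from
   the two inner masses. *)
pose c2 := (c `^ p * (t / 2 * 2 `^ a) ^+ 2 * delta `^ b)%R.
apply: (@integral_on_pinfty_const _ cl c2 b) => //.
- by rewrite !mulr_gt0 ?powR_gt0 ?exprn_gt0// !mulr_gt0 ?powR_gt0.
- by rewrite /b; move: ap; lra.
- move=> z _; apply: integral_on_ge0 => y _; apply: integral_on_ge0 => ? _.
  exact: poweR_ge0.
move=> rho rho0.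
have rho'0 : (0 < Num.min rho (Num.min rl ru))%R by rewrite !lt_min rho0 rl0.
have [r /andP[r0]] := Xt _ rho'0; rewrite !lt_min => /and3P[rrho rrl rru] rH.
have dr0 : (0 < delta * r)%R by rewrite mulr_gt0.
have er0 : (0 < eta * r)%R by rewrite mulr_gt0.
have drr : (delta * r < r)%R by rewrite gtr_pMl.
have err : (eta * r < r)%R by rewrite gtr_pMl//; move: eta12; lra.
exists (delta * r)%R; first by rewrite dr0 (lt_trans drr).
split; first by apply: Xl; rewrite dr0 (lt_trans drr).
move=> z Xz zx zr.
pose Q := eucl_ball x r `\` eucl_ball x (eta * r).
have mQ : measurable (Q : set (caratheodory_type (hausdorff_on X a))).
  by apply: measurableD; exact: measurable_eucl_ball.
pose m := (t / 2 * (2 * r) `^ a)%R.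
have m0 : (0 <= m)%R by rewrite mulr_ge0 ?powR_ge0// divr_ge0// ltW.
have wideQ s : s != 0%R -> m%:E <= H (X `&` (wide x s t `&` Q)).
  move=> s0; apply: (@lee_addKr _ m _ (H (X `&` eucl_ball x (eta * r)))).
    apply: le_trans (hausdorffU2 _ _ _).
    apply: le_trans (_ : H (X `&` wide x s t `&` eucl_ball x r) <= _).
      by rewrite -mulrDl -splitr rH.
    apply: le_hausdorff => y [[Xy yt] yr].
    by have [ye|ye] := pselect (eucl_ball x (eta * r) y); [right|left].
  apply: le_trans (Xu _ _) _; first by rewrite er0 (lt_trans err).
  rewrite lee_fin /m mulrCA powRM ?(ltW eta0) ?mulr_ge0 ?(ltW r0)// mulrA.
  by rewrite ler_wpM2r ?powR_ge0.
(* An arbitrary axis suffices, since the part outside its cone already has this mass. *)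
have Qm : m%:E <= H (X `&` Q).
  have [s s1] := @exists_unit_sphere R n n0.
  have s0 : s != 0%R by rewrite -eucl_norm_eq0 s1 oner_eq0.
  by apply: le_trans (wideQ s s0) _; apply: le_hausdorff => y [Xy []].
have Qx y : Q y -> y != x.
  move=> [_ ye]; apply: contra_notN ye => /eqP ->.
  by rewrite /eucl_ball/= eucl_distxx ltW.
have Qeta y : Q y -> (eta * r < eucl_dist y x)%R.
  by move=> [_ ye]; rewrite ltNge; apply/negP.
pose K := ((c / r) `^ p)%R.
have K0 : (0 <= K)%R by exact: powR_ge0.
have inner y : X y -> Q y -> (K * m)%:E <=
    integral_on X a (fun x' => kappa X x' y z `^ p).
  move=> Xy Qy; have yx := Qx y Qy.
  have mW : measurable (wide x (y - x)%R t `&` Q :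
      set (caratheodory_type (hausdorff_on X a))).
    by apply: measurableI => //; exact: measurable_wide.
  apply: le_trans (integral_on_ge a0 (c := K) mW K0 _ _).
  - by rewrite EFinM lee_wpmul2l// wideQ// subr_eq0.
  - by move=> ? _; exact: poweR_ge0.
  move=> v Xv [vt Qv]; apply: le_EFin_poweR => //; first by rewrite divr_ge0 ?ltW.
  have zd : (eucl_dist z x <= delta * r)%R by [].
  have vx := Qx v Qv; have vr := Qv.1; have yr := Qy.1.
  have zeta : (eucl_dist z x < eta * r)%R.
    by apply: le_lt_trans zd _; rewrite ltr_pM2r.
  have [|||D Dc] := @inv_circumradius_ge R n x v y z t r t0 r0 vx yx vr yr _ _ vt.
  - exact: lt_trans zeta (Qeta v Qv).
  - exact: lt_trans zeta (Qeta y Qy).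
  - have vy : (eucl_dist v y <= 2 * r)%R.
      have := eucl_dist_triangle x v y; rewrite (eucl_distC x y).
      by move: vr yr; rewrite /eucl_ball/=; lra.
    apply: (@le_trans _ _ (8 * r * (delta * r) * (2 * r) ^+ 2)%R).
      rewrite ler_pM ?mulr_ge0 ?eucl_dist_ge0 ?sqr_ge0//.
        by rewrite ler_pM ?mulr_ge0 ?eucl_dist_ge0// ler_wpM2l.
      by rewrite ler_sqr ?nnegrE ?eucl_dist_ge0// mulr_ge0 ?(ltW r0).
    apply: (@le_trans _ _ (t * ((eta * r) * (eta * r)) ^+ 2)%R).
      have : (0 <= t * eta ^+ 4 * r ^+ 4)%R.
        by rewrite !mulr_ge0 ?exprn_ge0 ?(ltW t0) ?(ltW eta0) ?(ltW r0).
      by rewrite /delta; lra.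
    have er20 : (0 <= (eta * r) * (eta * r))%R by rewrite -expr2 sqr_ge0.
    rewrite ler_wpM2l ?(ltW t0)// ler_sqr ?nnegrE//;
      last by rewrite mulr_ge0 ?eucl_dist_ge0.
    by rewrite ler_pM ?(ltW er0) ?(ltW (Qeta _ _)).
  by rewrite kappaE.
apply: le_trans (integral_on_ge a0 (c := (K * m)%R) mQ _ _ inner); last 2 first.
- by rewrite mulr_ge0.
- by move=> y _; apply: integral_on_ge0 => ? _; exact: poweR_ge0.
apply: (@le_trans _ _ ((K * m)%:E * m%:E)); last first.
  by rewrite lee_wpmul2l// lee_fin mulr_ge0.
rewrite -EFinM lee_fin /K /m /c2 (powR_div _ (ltW c0) r0).
rewrite (powRM _ (ler0n _ 2) (ltW r0)) (powRM _ (ltW delta0) (ltW r0)).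
have -> : (r `^ (- p) = r `^ (- b) * (r `^ a * r `^ a) ^-1)%R.
  rewrite -powRD ?(gt_eqF r0) ?implybT// -powRN -powRD ?(gt_eqF r0) ?implybT//.
  by congr (_ `^ _)%R; rewrite /b; ring.
have -> : (delta `^ (- b) = (delta `^ b)^-1)%R by rewrite powRN.
have ra0 : (r `^ a != 0)%R by rewrite gt_eqF// powR_gt0.
have db0 : (delta `^ b != 0)%R by rewrite gt_eqF// powR_gt0.
by rewrite le_eqVlt; apply/orP; left; apply/eqP; field; rewrite ra0 db0.
Qed.

End energies_facts.


(** * Existence of tangents from finite thickness or energy *)

Theorem theorem1p1 (R : realType) (n : nat) (hn : (0 < n)%N)
    (X : set 'rV[R]_n) (x : 'rV[R]_n) (alpha : R) (halpha : (0 < alpha)%R) :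
  [/\ ((thickness X)^-1 < +oo -> hausdorff eucl_dist 1 X < +oo ->
        approx_tangent 1 X x),
      (forall p : R, (alpha <= p)%R ->
        energy_U X alpha p < +oo ->
        approx_tangent alpha X x),
      (forall p : R, (2 * alpha <= p)%R ->
        energy_I X alpha p < +oo ->
        0 < lower_density alpha X x ->
        weak_approx_tangent alpha X x) &
      (forall p : R, (3 * alpha <= p)%R ->
        energy_M X alpha p < +oo ->
        0 < lower_density alpha X x <= upper_density alpha X x ->
        upper_density alpha X x < +oo ->
        weak_approx_tangent alpha X x)].
Proof.
split.
- move=> tX _; have [[t t0 Xt]|[s s1 Xs]] := spread_or_tangent_line X x hn.
    by move: tX; rewrite (spread_thickness t0 Xt).
  exact: (tangent_line_approx_tangent ltr01 s1 Xs).
- move=> p ap UX.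
  have [[t t0 Xt]|[s s1 Xs]] := spread_or_tangent_line X x hn; last first.
    exact: tangent_line_approx_tangent s1 Xs.
  apply: contrapT => nX; move: UX.
  by rewrite (spread_energy_U halpha t0 Xt hn ap nX).
- move=> p ap IX _.
  have [[t t0 Xt]|[s s1 Xs]] := spread_or_tangent_line X x hn; last first.
    exact: approx_tangent_weak (tangent_line_approx_tangent halpha s1 Xs).
  apply: contrapT => nX; move: IX.
  by rewrite (limit_pt_energy_I halpha (spread_limit_pt Xt) ap nX).
- move=> p ap MX /andP[lX _] uX; apply: contrapT => nX; move: MX.
  by rewrite (density_energy_M halpha hn ap lX uX nX).
Qed.
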